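(* Assume $t\mapsto e(t)$ $(0\le t<T)$ is a maximal trajectory arising from the dynamics $\dot e(t)=x^{(n-2)}_{e(t)}-e(t)$, starting at $e(0)\in\mathrm{Swath}(n-2)\setminus\mathrm{Core}(n-2)$. If $e(0)$ lies in the central path, then $\{e(t):0\le t<T\}$ is contained in the central path.
   Context: $\mathcal{E}$ is a finite-dimensional Euclidean space. $p:\mathcal{E}\to\mathbb{R}$ is a homogeneous polynomial of degree $n$ that is hyperbolic in some direction $e_0$: $p(e_0)>0$ and for every $x$ all roots of $t\mapsto p(x+te_0)$ are real. $\Lambda_{++}$ is the connected component of $\{p>0\}$ containing $e_0$, and $\Lambda_+$ is its closure. Known (Gårding): $\Lambda_{++}$ is convex and $p$ is hyperbolic in every direction $e\in\Lambda_{++}$. For $e\in\Lambda_{++}$ and $0\le i\le n-1$, $p_e^{(i)}(x):=D^ip(x)[e,\dots,e]$ ($i$ copies of $e$; $p_e^{(0)}=p$), which is hyperbolic in direction $e$ of degree $n-i$; $\Lambda^{(i)}_{++,e}$ is the connected component of $\{p_e^{(i)}>0\}$ containing $e$, and $\Lambda^{(i)}_{+,e}$ its closure. Standing assumptions: $\Lambda_+$ is regular (nonempty interior, contains no linear subspace other than $\{0\}$); $A:\mathcal{E}\to\mathbb{R}^m$ is linear and surjective; $0\ne b\in\mathbb{R}^m$; $c^*$ is a linear functional on $\mathcal{E}$ not in the image of $A^*$ (i.e. not of the form $y^*A$). HP is the problem of minimizing $c^*x$ subject to $Ax=b$, $x\in\Lambda_+$; $\mathrm{Opt}$ is its set of optimal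 solutions. $\mathrm{HP}^{(i)}_e$ is the problem of minimizing $c^*x$ subject to $Ax=b$, $x\in\Lambda^{(i)}_{+,e}$, and $\mathrm{Opt}^{(i)}_e$ is its set of optimal solutions. For $0\le i\le n-1$, $\mathrm{Swath}(i):=\{e\in\Lambda_{++}: Ae=b,\ \mathrm{Opt}^{(i)}_e\ne\emptyset\}$ and $\mathrm{Core}(i):=\{e\in\mathrm{Swath}(i):\mathrm{Opt}^{(i)}_e=\mathrm{Opt}\}$. For $1\le i\le n-2$ and $e\in\mathrm{Swath}(i)\setminus\mathrm{Core}(i)$, the set $\mathrm{Opt}^{(i)}_e$ consists of exactly one point, denoted $x^{(i)}_e$. (When $n=2$, $\mathrm{Swath}(n-2)\setminus\mathrm{Core}(n-2)$ is empty and the statement is vacuous.) Maximal trajectory: for $1\le i\le n-2$, the set $\mathrm{Swath}(i)\setminus\mathrm{Core}(i)$ is relatively open in $\{x\in\Lambda_{++}:Ax=b\}$ and $e\mapsto x_e^{(i)}$ is analytic on it, so for each $e(0)$ in this set the differential equation $\dot e(t)=x^{(i)}_{e(t)}-e(t)$ has a unique solution in $\mathrm{Swath}(i)\setminus\mathrm{Core}(i)$ on a maximal interval $[0,T)$, $0<T\le\infty$; this solution is the maximal trajectory. The central path is the set $\{z(\eta):\eta>0\}$, where $z(\eta)$ denotes the minimizer (when it exists) of $\eta\,c^*x-\ln p(x)$ over $\{x\in\Lambda_{++}:Ax=b\}$. *)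

(* Defs.v *)
From mathcomp Require Import all_boot all_order all_algebra.
From mathcomp Require Import complex.
(* The notations of mpoly clash with those of the analysis library. *)
From mathcomp Require Import(canonicals,coercions) mpoly.
From mathcomp Require Import all_classical all_reals all_analysis.

Set Implicit Arguments.
Unset Strict Implicit.
Unset Printing Implicit Defensive.
Import Order.TTheory GRing.Theory Num.Theory.
Import numFieldNormedType.Exports.

Local Open Scope classical_set_scope.
Local Open Scope ring_scope.

Definition peval (R : realType) (d : nat) (p : mpoly.mpoly d R) (x : 'cV[R]_d) : R :=
  mpoly.meval (fun i => x i 0) p.

(* The value p(x + z e) of p at a complex point, for x, e real and z complex. *)
Definition peval_line (R : realType) (d : nat) (p : mpoly.mpoly d R)
    (x e : 'cV[R]_d) (z : complex R) : complex R :=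
  mpoly.mmap (real_complex R)
    (fun i => real_complex R (x i 0) + z * real_complex R (e i 0)) p.

Definition hyperbolic (R : realType) (d : nat) (p : mpoly.mpoly d R)
    (e : 'cV[R]_d) : Prop :=
  0 < peval p e /\
  forall (x : 'cV[R]_d) (z : complex R), peval_line p x e z = 0 -> complex.Im z = 0.

(* D^i p(x)[e, ..., e], as the i-fold iterated derivative in the direction e. *)
Definition pder (R : realType) (d : nat) (p : mpoly.mpoly d R) (e : 'cV[R]_d)
    (i : nat) : 'cV[R]_d -> R :=
  iter i (fun f => 'D_e f) (peval p).

Definition open_cone (R : realType) (d : nat) (q : 'cV[R]_d -> R)
    (e : 'cV[R]_d) : set 'cV[R]_d :=
  connected_component [set x | 0 < q x] e.

Definition closed_cone (R : realType) (d : nat) (q : 'cV[R]_d -> R)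
    (e : 'cV[R]_d) : set 'cV[R]_d :=
  closure (open_cone q e).

Definition regular_cone (R : realType) (d : nat) (K : set 'cV[R]_d) : Prop :=
  interior K !=set0 /\
  forall V : {vspace 'cV[R]_d}, (forall v, v \in V -> K v) -> V = 0%VS.

Section Program.
Variables (R : realType) (d m : nat).
Variables (p : mpoly.mpoly d R) (e0 : 'cV[R]_d).
Variables (A : {linear 'cV[R]_d -> 'cV[R]_m}) (b : 'cV[R]_m).
Variable c : {linear 'cV[R]_d -> R^o}.

Definition optimal_set (K : set 'cV[R]_d) : set 'cV[R]_d :=
  [set x | [/\ A x = b, K x &
    forall y, A y = b -> K y -> (c x : R) <= c y]].

Definition Opt : set 'cV[R]_d := optimal_set (closed_cone (peval p) e0).

Definition Opt_der (i : nat) (e : 'cV[R]_d) : set 'cV[R]_d :=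
  optimal_set (closed_cone (pder p e i) e).

Definition strictly_feasible : set 'cV[R]_d :=
  [set e | open_cone (peval p) e0 e /\ A e = b].

Definition Swath (i : nat) : set 'cV[R]_d :=
  [set e | strictly_feasible e /\ Opt_der i e !=set0].

Definition Core (i : nat) : set 'cV[R]_d :=
  [set e | Swath i e /\ Opt_der i e = Opt].

(* x_e^(i): Opt_der i e is a singleton for e in Swath i `\` Core i and
   1 <= i <= n - 2, and [get] then returns its unique element. *)
Definition opt_point (i : nat) (e : 'cV[R]_d) : 'cV[R]_d := get (Opt_der i e).

Definition time_interval (T : \bar R) : set R :=
  [set t | 0 <= t /\ (t%:E < T)%E].

(* The derivative at t is the limit of difference quotients over times s in
   [0, T): it is two-sided for t > 0 and one-sided at t = 0.  The values of
   e outside [0, T) are irrelevant. *)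
Definition trajectory (i : nat) (T : \bar R) (e : R -> 'cV[R]_d) : Prop :=
  (0 < T)%E /\
  forall t, time_interval T t ->
    (Swath i `\` Core i) (e t) /\
    (s - t)^-1 *: (e s - e t) @[s --> within (time_interval T `\ t) (nbhs t)]
      --> opt_point i (e t) - e t.

Definition maximal_trajectory (i : nat) (T : \bar R) (e : R -> 'cV[R]_d) : Prop :=
  trajectory i T e /\
  forall (T' : \bar R) (e' : R -> 'cV[R]_d),
    (T <= T')%E -> trajectory i T' e' ->
    (forall t, time_interval T t -> e' t = e t) -> T' = T.

Definition central_path : set 'cV[R]_d :=
  [set z | exists2 eta : R, 0 < eta &
    strictly_feasible z /\
    forall y, strictly_feasible y ->
      eta * c z - ln (peval p z) <= eta * c y - ln (peval p y)].

End Program.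

(* Main.v *)
(* A strictly feasible [z] is on the central path iff [Dp(z) = eta p(z) c] on [ker A] for
   some [eta > 0] (sufficiency: [ln p] is concave on the hyperbolicity cone).  Since [p]
   is homogeneous, the derivative of order [n - 2] of [p] in direction [e] is, up to a
   positive factor, the quadratic form [D^2p(e)], and the optimality of [x] in the
   relaxed program gives [D^2p(e)[x, .] = mu c] on [ker A] with [mu >= 0].  Along a
   trajectory, for [v] in [ker A], Euler's identity therefore yields
     d/dt Dp(e)[v] = D^2p(e)[x - e, v] = mu c(v) - (n - 1) Dp(e)[v],
   a linear equation whose solutions stay proportional to [c] on [ker A], with a
   positive factor, if they start so. *)

From HB Require Import structures.
Require Import Defs.
From mathcomp Require Import all_boot all_order all_algebra.
From mathcomp Require Import complex.
From mathcomp Require Import(canonicals,coercions) mpoly.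
From mathcomp Require Import all_classical all_reals all_analysis.
From mathcomp Require Import ring lra zify.

Import Order.TTheory GRing.Theory Num.Theory.
Import numFieldNormedType.Exports.

Local Open Scope classical_set_scope.
Local Open Scope ring_scope.

Set Implicit Arguments.
Unset Strict Implicit.
Unset Printing Implicit Defensive.

(** * Restriction of a polynomial to a line *)

(** The multiplier [mu] varies with the optimal point, and solving the linear equation would mean
    integrating it in time. Only its sign is kept: for [v] in [ker A] with [c v >= 0], optimality
    gives [D^2p(e)[x, v] >= 0], so [Dp(e(t))[v] * expR ((n - 1) * t)] is nondecreasing. When
    [c v = 0] this quantity starts at 0, and the bounds for [v] and [- v] force it to stay there; a
    fixed [u] in [ker A] with [c u > 0] shows that the factor of proportionality stays positive.
    Hyperbolicity is given along [e0], but it is at [e(t)] that real roots are wanted, both for the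
    concavity of [ln p] and for the relaxed cone; hence Garding's theorem. Real roots at [e(t)] make
    [D^2p(e(t))] Lorentzian, and this turns the relaxed cone, defined as a connected component, into
    one nappe of an explicit quadratic cone. *)

Lemma mpoly_alg_ind (R : nzRingType) (d : nat) (P : mpoly.mpoly d R -> Prop) :
  (forall c, P (mpoly.mpolyC d c)) ->
  (forall i, P (mpoly.mpolyX R (mpoly.mnm1 i))) ->
  (forall q r : mpoly.mpoly d R, P q -> P r -> P (q + r)) ->
  (forall q r : mpoly.mpoly d R, P q -> P r -> P (q * r)) ->
  forall q, P q.
Proof.
move=> PC PX PD PM; elim/mpoly.mpolyind; first by rewrite -(mpoly.mpolyC0 d R).
move=> c m q _ _ Pq; apply: (PD) => //; rewrite -mpoly.mul_mpolyC; apply: (PM) => //.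
rewrite mpoly.mpolyXE_id; apply: big_ind => [|q' r'|i _].
- by rewrite -(mpoly.mpolyC1 d R).
- exact: PM.
- elim: (m i) => [|k IH]; first by rewrite expr0 -(mpoly.mpolyC1 d R).
  by rewrite exprS; apply: PM.
Qed.

(** The polynomial [s |-> q (u + s w)]. With [f := idfun] its coefficients are the Taylor
    coefficients of [q] at [u]; with [real_complex] it has the complex roots that hyperbolicity
    speaks of. *)
Definition line_poly {R K : comNzRingType} {d : nat} (f : {rmorphism R -> K})
    (u w : 'I_d -> K) (q : mpoly.mpoly d R) : {poly K} :=
  mpoly.mmap (polyC \o f) (fun i => (u i)%:P + (w i)%:P * 'X) q.

Lemma horner_line_poly (R K : comNzRingType) (d : nat) (f : {rmorphism R -> K})
    (u w : 'I_d -> K) (q : mpoly.mpoly d R) (s : K) :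
  (line_poly f u w q).[s] = mpoly.mmap f (fun i => u i + s * w i) q.
Proof.
rewrite /line_poly; elim/mpoly_alg_ind: q => [c|i|q r Hq Hr|q r Hq Hr].
- by rewrite !mpoly.mmapC hornerC.
- by rewrite !mpoly.mmapX !mpoly.mmap1U !hornerE mulrC.
- by rewrite !raddfD /= hornerD Hq Hr.
- by rewrite !rmorphM /= hornerM Hq Hr.
Qed.

Lemma map_line_poly (R K : comNzRingType) (d : nat) (f : {rmorphism R -> K})
    (u w : 'I_d -> R) (q : mpoly.mpoly d R) :
  map_poly f (line_poly idfun u w q) = line_poly f (f \o u) (f \o w) q.
Proof.
rewrite /line_poly; elim/mpoly_alg_ind: q => [c|i|q r Hq Hr|q r Hq Hr].
- by rewrite !mpoly.mmapC map_polyC.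
- by rewrite !mpoly.mmapX !mpoly.mmap1U rmorphD rmorphM /= !map_polyC map_polyX.
- by rewrite !raddfD /= Hq Hr.
- by rewrite !rmorphM /= Hq Hr.
Qed.

Lemma mmap_real_points (R K : comNzRingType) (d : nat) (f : {rmorphism R -> K})
    (u : 'I_d -> R) (q : mpoly.mpoly d R) :
  f (mpoly.meval u q) = mpoly.mmap f (f \o u) q.
Proof.
elim/mpoly_alg_ind: q => [c|i|q r Hq Hr|q r Hq Hr].
- by rewrite mpoly.mevalC mpoly.mmapC.
- by rewrite mpoly.mevalXU mpoly.mmapX mpoly.mmap1U.
- by rewrite !raddfD /= Hq Hr.
- by rewrite !rmorphM /= Hq Hr.
Qed.

Lemma coef_top_mul (K : nzRingType) (k l : nat) (g h : {poly K}) :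
  (size g <= k.+1)%N -> (size h <= l.+1)%N ->
  (size (g * h)%R <= (k + l).+1)%N /\ (g * h)`_(k + l) = g`_k * h`_l.
Proof.
move=> sg sh; split.
  apply: leq_trans (size_polyMleq _ _) _.
  by move: sg sh; case: (size g) => [|a]; case: (size h) => [|b] /=; lia.
rewrite coefM (bigD1 (inord k : 'I_(k + l).+1)) //= inordK; last by rewrite ltnS leq_addr.
rewrite addKn big1 ?addr0 // => i; rewrite -val_eqE /= inordK ?ltnS ?leq_addr // => nik.
have [ltik|leki] := ltnP i k.
  by rewrite (nth_default _ (s := h)) ?mulr0 // (leq_trans sh) //; lia.
by rewrite (nth_default _ (s := g)) ?mul0r // (leq_trans sg) // ltn_neqAle eq_sym nik.
Qed.

Lemma mmap_homog (R K : comNzRingType) (d n : nat) (f : {rmorphism R -> K})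
    (p : mpoly.mpoly d R) (c : K) (w : 'I_d -> K) :
  p \is mpoly.ishomog1 n mpoly.mdeg ->
  mpoly.mmap f (fun i => c * w i) p = c ^+ n * mpoly.mmap f w p.
Proof.
move=> /mpoly.dhomogP hp; rewrite /mpoly.mmap mulr_sumr; apply: eq_big_seq => m hm.
have {hm}<- : mpoly.mdeg m = n := hp _ hm.
rewrite mulrCA; congr (_ * _); rewrite /mpoly.mmap1 mpoly.mdegE.
rewrite expr_sum -big_split; apply: eq_bigr => i _; exact: exprMn.
Qed.

(** Every monomial of degree [n] contributes the product of its leading coefficients, so the top
    coefficient does not see the base point [u]: it stays constant when the line is translated. *)
Lemma line_poly_top (R K : comNzRingType) (d n : nat) (f : {rmorphism R -> K})
    (u w : 'I_d -> K) (p : mpoly.mpoly d R) :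
  p \is mpoly.ishomog1 n mpoly.mdeg ->
  (size (line_poly f u w p) <= n.+1)%N /\
  (line_poly f u w p)`_n = mpoly.mmap f w p.
Proof.
move=> /mpoly.dhomogP hp'.
have {hp'}hp m : m \in mpoly.msupp p -> mpoly.mdeg m = n := hp' m.
have lin i : (size ((u i)%:P + (w i)%:P * 'X)%R <= 2)%N /\
    ((u i)%:P + (w i)%:P * 'X)`_1 = w i.
  split; last by rewrite coefD coefC mulrC coefXM coefC /= add0r.
  rewrite (leq_trans (size_polyD _ _)) // geq_max (leq_trans (size_polyC_leq1 _)) //=.
  by rewrite (leq_trans (size_polyMleq _ _)) // size_polyX addn2 /= ltnS size_polyC_leq1.
have pow i k : (size (((u i)%:P + (w i)%:P * 'X) ^+ k)%R <= k.+1)%N /\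
    (((u i)%:P + (w i)%:P * 'X) ^+ k)`_k = w i ^+ k.
  elim: k => [|k [IH1 IH2]]; first by rewrite !expr0 coef1 size_poly1.
  have [l1 l2] := lin i.
  have [] := coef_top_mul l1 IH1.
  by rewrite -!exprS add1n IH2 l2 -exprS.
have mon m : (size (mpoly.mmap1 (fun i => (u i)%:P + (w i)%:P * 'X)%R m)
      <= (mpoly.mdeg m).+1)%N /\
    (mpoly.mmap1 (fun i => (u i)%:P + (w i)%:P * 'X) m)`_(mpoly.mdeg m)
      = mpoly.mmap1 w m.
  rewrite /mpoly.mmap1 mpoly.mdegE.
  elim/big_rec3: _ => [|i y1 y2 y3 _ [IH1 IH2]]; first by rewrite coef1 size_poly1.
  have [p1 p2] := pow i (m i).
  have [] := coef_top_mul p1 IH1.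
  by rewrite p2 IH2.
split.
  rewrite /line_poly /mpoly.mmap big_seq_cond.
  apply: (big_ind (fun g : {poly K} => size g <= n.+1)%N) => [|g h sg sh|m /andP[hm _]].
  - by rewrite size_poly0.
  - by rewrite (leq_trans (size_polyD _ _)) // geq_max sg.
  - rewrite /= mul_polyC (leq_trans (size_scale_leq _ _)) //.
    by rewrite -(hp _ hm); case: (mon m).
rewrite /line_poly /mpoly.mmap coef_sum; apply: eq_big_seq => m hm.
by rewrite /= coefCM -{1}(hp _ hm); have [_ ->] := mon m.
Qed.

(** * Formal directional derivatives, Euler's identities and Taylor coefficients *)

Definition dir_deriv {R : comNzRingType} {d : nat} (w : 'I_d -> R)
    (q : mpoly.mpoly d R) : mpoly.mpoly d R :=
  \sum_i w i *: mpoly.mderiv i q.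

Lemma dir_derivM (R : comNzRingType) (d : nat) (w : 'I_d -> R) (q r : mpoly.mpoly d R) :
  dir_deriv w (q * r) = dir_deriv w q * r + q * dir_deriv w r.
Proof.
rewrite /dir_deriv mulr_suml mulr_sumr -big_split; apply: eq_bigr => i _ /=.
by rewrite mpoly.mderivM scalerDr scalerAl scalerAr.
Qed.

Lemma dir_derivD (R : comNzRingType) (d : nat) (w : 'I_d -> R) (q r : mpoly.mpoly d R) :
  dir_deriv w (q + r) = dir_deriv w q + dir_deriv w r.
Proof.
rewrite /dir_deriv -big_split; apply: eq_bigr => i _ /=.
by rewrite mpoly.mderivD scalerDr.
Qed.

Lemma dir_derivC (R : comNzRingType) (d : nat) (w : 'I_d -> R) (c : R) :
  dir_deriv w (mpoly.mpolyC d c) = 0.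
Proof. by rewrite /dir_deriv big1 // => i _; rewrite mpoly.mderivC scaler0. Qed.

Lemma dir_derivX (R : comNzRingType) (d : nat) (w : 'I_d -> R) (i : 'I_d) :
  dir_deriv w (mpoly.mpolyX R (mpoly.mnm1 i)) = mpoly.mpolyC d (w i).
Proof.
rewrite /dir_deriv (bigD1 i) //= big1 => [|j nji].
  by rewrite mpoly.mderivX mpoly.mnm1E eqxx scale1r -[X in mpoly.mnm_sub X _]mpoly.add0m mpoly.addmK
    mpoly.mpolyX0 addr0 -mpoly.mul_mpolyC mulr1.
by rewrite mpoly.mderivX mpoly.mnm1E eq_sym (negbTE nji) scale0r scaler0.
Qed.

Lemma mderiv_sum (R : comNzRingType) (d : nat) (I : Type) (s : seq I)
    (i : 'I_d) (F : I -> mpoly.mpoly d R) :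
  mpoly.mderiv i (\sum_(k <- s) F k) = \sum_(k <- s) mpoly.mderiv i (F k).
Proof. exact: raddf_sum. Qed.

Lemma dir_deriv2E (R : comNzRingType) (d : nat) (u w : 'I_d -> R) (q : mpoly.mpoly d R) :
  dir_deriv u (dir_deriv w q) =
  \sum_i \sum_j (u i * w j) *: mpoly.mderiv i (mpoly.mderiv j q).
Proof.
apply: eq_bigr => i _; rewrite mderiv_sum; apply: etrans (scaler_sumr _ _ _ _) _.
by apply: eq_bigr => j _; rewrite mpoly.mderivZ scalerA.
Qed.

Lemma dir_deriv_sym (R : comNzRingType) (d : nat) (u w : 'I_d -> R) (q : mpoly.mpoly d R) :
  dir_deriv u (dir_deriv w q) = dir_deriv w (dir_deriv u q).
Proof.
rewrite !dir_deriv2E exchange_big; apply: eq_bigr => i _; apply: eq_bigr => j _ /=.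
by rewrite mulrC mpoly.mderiv_comm.
Qed.

Lemma meval_dir_deriv (R : comNzRingType) (d : nat) (u w : 'I_d -> R) (q : mpoly.mpoly d R) :
  mpoly.meval u (dir_deriv w q) = \sum_i w i * mpoly.meval u (mpoly.mderiv i q).
Proof.
rewrite /dir_deriv (raddf_sum (mpoly.meval u)) /=.
by apply: eq_bigr => i _; apply: mpoly.mevalZ.
Qed.

Lemma euler_homog (R : comNzRingType) (d n : nat) (p : mpoly.mpoly d R) :
  p \is mpoly.ishomog1 n mpoly.mdeg ->
  \sum_i mpoly.mpolyX R (mpoly.mnm1 i) * mpoly.mderiv i p = p *+ n.
Proof.
move=> /mpoly.dhomogP hp'.
have {hp'}hp m : m \in mpoly.msupp p -> mpoly.mdeg m = n := hp' m.
rewrite {2}(mpoly.mpolyE p) -sumrMnl.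
under eq_bigr => i _ do rewrite {1}(mpoly.mpolyE p) mderiv_sum mulr_sumr.
rewrite exchange_big /=; apply: eq_big_seq => m hm.
under eq_bigr => i _ do rewrite mpoly.mderivZ mpoly.mderivX -scalerAr.
rewrite -scaler_sumr scalerMnr; congr (_ *: _).
rewrite -(hp m hm) mpoly.mdegE -sumrMnr; apply: eq_bigr => i _.
rewrite -scalerAr -mpoly.mpolyXD scaler_nat.
(* At [m i = 0] the subtraction of monomials truncates, but the factor [m i] makes both sides
   zero. *)
have [->|mi] := posnP (m i); first by rewrite !mulr0n.
by rewrite mpoly.addmC mpoly.submK // mpoly.lep1mP -lt0n.
Qed.

Lemma euler_meval (R : comNzRingType) (d n : nat) (p : mpoly.mpoly d R) (u : 'I_d -> R) :
  p \is mpoly.ishomog1 n mpoly.mdeg ->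
  mpoly.meval u (dir_deriv u p) = n%:R * mpoly.meval u p.
Proof.
move=> hp; rewrite meval_dir_deriv mulr_natl -mpoly.mevalMn -(euler_homog hp).
rewrite (raddf_sum (mpoly.meval u)) /=.
by apply: eq_bigr => i _; rewrite mpoly.mevalM mpoly.mevalXU.
Qed.

(** Differentiate Euler's identity in direction [w]: the derivatives of the variables produce one
    copy of [dir_deriv w p], whence [n - 1]. *)
Lemma euler_meval2 (R : comNzRingType) (d n : nat) (p : mpoly.mpoly d R) (u w : 'I_d -> R) :
  p \is mpoly.ishomog1 n mpoly.mdeg ->
  mpoly.meval u (dir_deriv u (dir_deriv w p)) = (n%:R - 1) * mpoly.meval u (dir_deriv w p).
Proof.
move=> /euler_homog hp; have := congr1 (mpoly.meval u \o dir_deriv w) hp.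
rewrite /= -[X in _ = X](_ : (mpoly.meval u (dir_deriv w p)) *+ n = _); last first.
  rewrite -mpoly.mevalMn; congr mpoly.meval.
  by rewrite /dir_deriv -sumrMnl; apply: eq_bigr => i _; rewrite mpoly.mderivMn scalerMnr.
rewrite mulrBl mul1r mulr_natl => <-.
rewrite [dir_deriv w (\sum_i _)](_ : _ = \sum_i dir_deriv w
    (mpoly.mpolyX R (mpoly.mnm1 i) * mpoly.mderiv i p)); last first.
  apply: (big_morph _ (dir_derivD w)).
  by rewrite -(mpoly.mpolyC0 d R) dir_derivC.
under eq_bigr => i _ do rewrite dir_derivM dir_derivX.
rewrite big_split /= mpoly.mevalD.
have -> : \sum_i mpoly.mpolyC d (w i) * mpoly.mderiv i p = dir_deriv w p.
  by apply: eq_bigr => i _; rewrite mpoly.mul_mpolyC.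
rewrite addrC addKr meval_dir_deriv; have := raddf_sum (mpoly.meval u).
move=> /= ->; apply: eq_bigr => i _; rewrite mpoly.mevalM mpoly.mevalXU.
congr (_ * mpoly.meval u _); rewrite /dir_deriv mderiv_sum.
by apply: eq_bigr => j _; rewrite mpoly.mderivZ mpoly.mderiv_comm.
Qed.

Lemma deriv_line_poly (R : comNzRingType) (d : nat) (u w : 'I_d -> R) (q : mpoly.mpoly d R) :
  (line_poly idfun u w q)^`() = line_poly idfun u w (dir_deriv w q).
Proof.
rewrite /line_poly; elim/mpoly_alg_ind: q => [c|i|q r Hq Hr|q r Hq Hr].
- by rewrite dir_derivC mpoly.mmap0 mpoly.mmapC /= derivC.
- rewrite dir_derivX mpoly.mmapX mpoly.mmap1U mpoly.mmapC derivD derivM !derivC derivX.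
  by rewrite mul0r !add0r mulr1.
- by rewrite dir_derivD !mpoly.mmapD derivD Hq Hr.
- by rewrite dir_derivM mpoly.mmapD !rmorphM /= derivM Hq Hr.
Qed.

Lemma coef_line_poly (R : comNzRingType) (d : nat) (u w : 'I_d -> R)
    (q : mpoly.mpoly d R) (k : nat) :
  (line_poly idfun u w q)`_k *+ k`! = mpoly.meval u (iter k (dir_deriv w) q).
Proof.
have -> : mpoly.meval u (iter k (dir_deriv w) q)
    = (line_poly idfun u w (iter k (dir_deriv w) q))`_0.
  rewrite -horner_coef0 horner_line_poly; apply: mpoly.meval_eq => i.
  by rewrite mul0r addr0.
suff -> : line_poly idfun u w (iter k (dir_deriv w) q) = (line_poly idfun u w q)^`(k).
  by rewrite coef_derivn addn0 ffactnn.
by elim: k => // k IH; rewrite derivnS -IH iterS deriv_line_poly.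
Qed.

Lemma poly_eq_on_nonzero (K : numFieldType) (F G : {poly K}) :
  (forall t, t != 0 -> F.[t] = G.[t]) -> F = G.
Proof.
move=> FG; apply/eqP; rewrite -subr_eq0; apply/eqP.
apply: (@roots_geq_poly_eq0 _ _ [seq k.+1%:R | k <- iota 0 (size (F - G))]).
- apply/allP => _ /mapP[k _ ->].
  by rewrite rootE hornerD hornerN FG ?subrr // pnatr_eq0.
- rewrite map_inj_uniq ?iota_uniq // => a b /eqP.
  by rewrite eqr_nat => /eqP[].
- by rewrite size_map size_iota.
Qed.

(* Homogeneity: [p (u + t w) = t ^+ n * p (w + t^-1 u)]. *)
Lemma line_poly_rev (K : numFieldType) (d n : nat) (u w : 'I_d -> K)
    (p : mpoly.mpoly d K) (k : nat) :
  p \is mpoly.ishomog1 n mpoly.mdeg -> (k <= n)%N ->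
  (line_poly idfun u w p)`_k = (line_poly idfun w u p)`_(n - k).
Proof.
move=> hp kn.
suff -> : line_poly idfun u w p = \poly_(i < n.+1) (line_poly idfun w u p)`_(n - i).
  by rewrite coef_poly ltnS kn.
apply: poly_eq_on_nonzero => t t0.
have [sz _] := line_poly_top idfun w u hp.
rewrite horner_line_poly horner_poly.
rewrite -(@eq_bigr _ _ _ _ _ _ (fun i : 'I_n.+1 => t ^+ n *
    ((line_poly idfun w u p)`_(n - i) * t^-1 ^+ (n - i)))); last first.
  move=> i _; rewrite mulrCA exprVn -exprB ?leq_subr ?unitfE //.
  by rewrite subKn // -ltnS.
rewrite -mulr_sumr.
rewrite -(big_mkord xpredT (fun i => (line_poly idfun w u p)`_(n - i) * t^-1 ^+ (n - i))).
rewrite big_nat_rev /=.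
under eq_big_nat => i /andP[_ hi] do rewrite add0n subSS subKn //.
rewrite big_mkord -(horner_coef_wide _ sz) horner_line_poly -(mmap_homog _ _ _ hp).
apply: mpoly.meval_eq => i.
by rewrite mulrDr mulrA divff // mul1r addrC.
Qed.

(** * Hyperbolicity cones (Garding) *)

Section HalfPlane.
Variable R : realType.
Notation C := (complex R).

Lemma Re_le_norm (z : C) : (complex.Re z)%:C%C <= `|z|.
Proof. by apply: le_trans (normc_ge_Re z); rewrite lecR ler_norm. Qed.

(** With [h = - Re r], combine h <= |s - r| with weight 1 + |r| and |s| <= |s - r| + |r| with weight
    [h]. The factor 1 + |s| keeps the bound useful at infinity, the half plane being unbounded. *)
Lemma half_plane_linear_bound (r : C) : complex.Re r < 0 ->
  exists2 a : C, 0 < a & forall s : C, 0 <= complex.Re s -> a * (1 + `|s|) <= `|s - r|.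
Proof.
move=> r0; pose h : C := (- complex.Re r)%:C%C.
have h0 : 0 < h by rewrite /h ltcR oppr_gt0.
have den0 : 0 < 1 + h + `|r| by rewrite ltr_wpDr // addr_gt0.
exists (h / (1 + h + `|r|)); first by rewrite divr_gt0.
move=> s s0; rewrite mulrAC ler_pdivrMr //.
have hs : h <= `|s - r|.
  apply: le_trans (Re_le_norm _); rewrite /h lecR.
  by case: (s) (r) s0 => [a b] [a' b'] /= s0; rewrite -[leLHS]add0r lerD2r.
have sr : `|s| <= `|s - r| + `|r| by rewrite -{1}(subrK r s) ler_normD.
apply: (@le_trans _ _ (h + h * `|s - r| + h * `|r|)).
  by rewrite mulrDr mulr1 -addrA lerD2l -mulrDr ler_wpM2l // ltW.
rewrite !mulrDr mulr1 [`|s - r| * h]mulrC; apply: lerD; last by rewrite ler_wpM2r.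
by rewrite lerD2r.
Qed.

Lemma half_plane_bound (rs : seq C) : (forall r, r \in rs -> complex.Re r < 0) ->
  exists2 a : C, 0 < a & forall s : C, 0 <= complex.Re s ->
    a * (1 + `|s|) ^+ size rs <= `|(\prod_(r <- rs) ('X - r%:P)).[s]|.
Proof.
elim: rs => [|r rs IH] hrs.
  by exists 1 => // s _; rewrite big_nil hornerC normr1 expr0 mulr1.
have [a a0 ha] := IH (fun r' h => hrs r' (mem_behead (s := r :: rs) h)).
have [b b0 hb] := half_plane_linear_bound (hrs r (mem_head _ _)).
exists (b * a); first exact: mulr_gt0.
move=> s s0; rewrite big_cons hornerM normrM hornerXsubC exprS mulrACA.
by apply: ler_pM; rewrite ?mulr_ge0 ?exprn_ge0 ?addr_ge0 ?(ltW a0) ?(ltW b0) ?hb ?ha.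
Qed.

(** The growth in [s] is that of [half_plane_bound], so a small change of the coefficients is
    dominated on the whole half plane at once. *)
Lemma poly_dist_bound (n : nat) (F G : {poly C}) (eps s : C) :
  (size F <= n.+1)%N -> (size G <= n.+1)%N ->
  (forall i : 'I_n.+1, `|F`_i - G`_i| <= eps) ->
  `|F.[s] - G.[s]| <= eps * n.+1%:R * (1 + `|s|) ^+ n.
Proof.
move=> sF sG FG; rewrite !(@horner_coef_wide _ n.+1) // -sumrB.
apply: le_trans (ler_norm_sum _ _ _) _.
rewrite -mulrA [n.+1%:R * _]mulrC mulrA -[n.+1%:R]/(n.+1%:R) mulr_natr.
rewrite -[n.+1 in leRHS]card_ord -sumr_const; apply: ler_sum => i _.
rewrite -mulrBl normrM; apply: ler_pM; rewrite ?normr_ge0 //.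
rewrite normrX; apply: (@le_trans _ _ ((1 + `|s|) ^+ i)).
  by rewrite lerXn2r ?nnegrE ?addr_ge0 // lerDr.
by apply: ler_weXn2l; rewrite ?lerDl // -ltnS.
Qed.

Lemma poly_prod_roots (n : nat) (F : {poly C}) :
  (size F <= n.+1)%N -> F`_n != 0 ->
  exists2 rs : seq C, size rs = n & F = F`_n *: \prod_(r <- rs) ('X - r%:P).
Proof.
move=> sF Fn; have [rs Frs] := closed_field_poly_normal F.
have sz : size F = n.+1.
  by apply/eqP; rewrite eqn_leq sF ltnNge; apply: contra Fn => /(nth_default 0) ->.
have lF : lead_coef F = F`_n by rewrite lead_coefE sz.
exists rs; last by rewrite -lF.
have := size_prod_XsubC rs id; rewrite -(size_scale _ Fn) -lF -Frs sz.
by case.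
Qed.

(* The parameters [x] for which [P x] has no root in the closed right half plane
   form a clopen subset of [D].  The constant leading coefficient keeps the roots
   bounded: the set is open since on it [`|(P x).[s]| >= a * (1 + `|s|) ^+ n], and
   relatively closed since on it [`|(P x).[s]| >= `|c| * (Re s) ^+ n]. *)
Lemma half_plane_root_free (X : topologicalType) (D : set X) (P : X -> {poly C})
    (n : nat) (c : C) (x0 : X) :
  connected D -> D x0 -> c != 0 ->
  (forall x, size (P x) <= n.+1)%N -> (forall x, (P x)`_n = c) ->
  (forall i, continuous (fun x => (P x)`_i : C^o)) ->
  (forall x s, D x -> complex.Re s = 0 -> (P x).[s] != 0) ->
  (forall s, 0 <= complex.Re s -> (P x0).[s] != 0) ->
  forall x s, D x -> 0 <= complex.Re s -> (P x).[s] != 0.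
Proof.
move=> connD Dx0 c0 szP topP contP axisP P0.
have coefs_near x (eps : C) : 0 < eps ->
    \forall y \near x, forall i : 'I_n.+1, `|(P y)`_i - (P x)`_i| <= eps.
  move=> eps0; apply: filter_forall => i.
  have /cvgr_dist_le/(_ eps eps0) := contP i x.
  by apply: filterS => y; rewrite distrC.
pose U := [set x | forall s : C, 0 <= complex.Re s -> (P x).[s] != 0].
have factorP x : exists2 rs : seq C, size rs = n &
    P x = c *: \prod_(r <- rs) ('X - r%:P).
  by rewrite -(topP x); apply: poly_prod_roots => //; rewrite topP.
have openU : open U.
  rewrite openE => x Ux; rewrite /interior /=.
  have [rs srs Prs] := factorP x.
  have [|a a0 ha] := @half_plane_bound rs.
    move=> r rrs; rewrite ltNge; apply/negP => /Ux; rewrite Prs hornerZ.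
    by rewrite (rootP _) ?mulr0 ?eqxx // root_prod_XsubC.
  (* The perturbation then amounts to at most half of the lower bound of [ha], uniformly in [s]. *)
  pose eps : C := `|c| * a / (n.+1%:R + n.+1%:R).
  have eps0 : 0 < eps by rewrite divr_gt0 ?mulr_gt0 ?normr_gt0 // -natrD ltr0n addSn.
  near=> y.
  move=> s s0; apply/negP => /eqP Py0.
  have : `|(P y).[s] - (P x).[s]| <= eps * n.+1%:R * (1 + `|s|) ^+ n.
    by apply: poly_dist_bound => //; near: y; exact: coefs_near.
  rewrite Py0 sub0r normrN Prs hornerZ normrM => le1.
  have := ha _ s0; rewrite srs -(@ler_pM2l _ `|c|) ?normr_gt0 // => le2.
  have := le_trans le2 le1; rewrite mulrA ler_pM2r ?exprn_gt0 ?ltr_wpDr //.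
  rewrite /eps mulrAC ler_pdivlMr -?natrD ?ltr0n // natrD mulrDr.
  by rewrite gerDl lt_geF ?mulr_gt0 ?normr_gt0.
have UW x s : U x -> 0 < complex.Re s ->
    `|c| * (complex.Re s)%:C%C ^+ n <= `|(P x).[s]|.
  move=> Ux s0; have [rs srs Prs] := factorP x.
  rewrite Prs hornerZ normrM ler_wpM2l // -srs.
  have {Prs} : forall r, r \in rs -> complex.Re r <= 0.
    move=> r rrs; rewrite leNgt; apply/negP => /ltW/Ux; rewrite Prs hornerZ.
    by rewrite (rootP _) ?mulr0 ?eqxx // root_prod_XsubC.
  elim: {srs} rs => [|r rs IH] hrs; first by rewrite big_nil hornerC normr1 expr0.
  rewrite big_cons hornerM normrM hornerXsubC exprS.
  apply: ler_pM; rewrite ?exprn_ge0 ?ler0c ?(ltW s0) //.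
    apply: le_trans (Re_le_norm _); rewrite lecR.
    have := hrs r (mem_head _ _); case: (s) (r) => [u v] [u' v'] /= u'0.
    by rewrite lerDl oppr_ge0.
  by apply: IH => r' r'rs; apply: hrs; rewrite inE r'rs orbT.
(* [UW] asks for a positive real part, so the imaginary axis is left to [axisP]. Elsewhere the lower
   bound of [UW] holds on all of [U] and survives in the limit. *)
have closedU x : D x -> closure U x -> U x.
  move=> Dx clx s; rewrite le_eqVlt => /predU1P[/esym|] s0; first exact: axisP.
  apply/negP => /eqP Px0.
  have s1 : 0 < `|c| * (complex.Re s)%:C%C ^+ n.
    by rewrite mulr_gt0 ?normr_gt0 // exprn_gt0 // ltcR.
  pose den : C := n.+1%:R * (1 + `|s|) ^+ n.
  have den0 : 0 < den by rewrite mulr_gt0 ?ltr0n // exprn_gt0 // ltr_wpDr.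
  pose eps : C := `|c| * (complex.Re s)%:C%C ^+ n / (den + den).
  have eps0 : 0 < eps by rewrite divr_gt0 // addr_gt0.
  have [y [Uy yx]] := clx _ (coefs_near x eps eps0).
  have := poly_dist_bound s (szP y) (szP x) yx.
  rewrite Px0 subr0 => /(le_trans (UW y s Uy s0)).
  rewrite -mulrA -/den /eps mulrAC ler_pdivlMr ?addr_gt0 // mulrDr.
  by rewrite gerDl (lt_geF (mulr_gt0 s1 den0)).
suff <- : D `&` U = D by move=> x s [_ Ux]; apply: Ux.
apply/connD; first by exists x0.
- by exists U.
- exists (closure U); first exact: closed_closure.
  apply/seteqP; split=> x [Dx Ux]; split=> //; first exact: subset_closure.
  exact: closedU.
Unshelve. all: by end_near.
Qed.

End HalfPlane.

Lemma continuous_real_complex (R : realType) :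
  continuous (fun a : R => (real_complex R a : (complex R)^o)).
Proof.
move=> a; apply/cvgrPdist_lt => eps eps0.
have e0 : 0 < complex.Re eps by case: eps eps0 => [u v]; rewrite ltcE /= => /andP[].
have eE : eps = (complex.Re eps)%:C%C.
  by case: eps eps0 {e0} => [u v]; rewrite ltcE /= => /andP[/eqP->].
near=> b.
rewrite -[X in X < _]/(`|real_complex R a - real_complex R b|) -rmorphB.
rewrite normc_def /= expr0n addr0 sqrtr_sqr eE ltcR; near: b.
exact: (@cvgr_dist_lt _ _ _ _ _ id a).
Unshelve. all: by end_near.
Qed.

Lemma continuous_coef_line_poly (R : comNzRingType) (K : numFieldType)
    (f : {rmorphism R -> K}) (X : topologicalType) (d : nat)
    (u w : X -> 'I_d -> K) (q : mpoly.mpoly d R) (k : nat) :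
  (forall i, continuous (fun x => u x i : K^o)) ->
  (forall i, continuous (fun x => w x i : K^o)) ->
  continuous (fun x => (line_poly f (u x) (w x) q)`_k : K^o).
Proof.
move=> cu cw; rewrite /line_poly; elim/mpoly_alg_ind: q k => [c|i|q r Hq Hr|q r Hq Hr] k.
- rewrite (_ : (fun _ => _) = fun=> ((f c)%:P)`_k); first exact: cst_continuous.
  by apply/funext => y; rewrite mpoly.mmapC.
- rewrite (_ : (fun _ => _) =
      fun y => (u y i *+ (k == 0%N) + w y i *+ (k == 1%N)) : K^o); last first.
    apply/funext => y; rewrite mpoly.mmapX mpoly.mmap1U coefD coefCM coefC coefX.
    by rewrite mulr_natr; case: (k == 0%N).
  by move=> y; apply: cvgD; apply: cvgMn; [exact: cu | exact: cw].
- under eq_fun => y do rewrite mpoly.mmapD coefD.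
  by move=> y; apply: cvgD; [exact: Hq | exact: Hr].
- under eq_fun => y do rewrite rmorphM coefM.
  move=> y; apply: cvg_big => [|i _]; first exact: add_continuous.
  by apply: cvgM; [exact: Hq | exact: Hr].
Qed.

Lemma peval_line_horner (R : realType) (d : nat) (p : mpoly.mpoly d R)
    (x e : 'cV[R]_d) (z : complex R) :
  peval_line p x e z =
  (line_poly (real_complex R) (fun i => real_complex R (x i 0))
    (fun i => real_complex R (e i 0)) p).[z].
Proof. by rewrite horner_line_poly. Qed.

Lemma peval_real_complex (R : realType) (d : nat) (p : mpoly.mpoly d R) (x : 'cV[R]_d) :
  mpoly.mmap (real_complex R) (fun i => real_complex R (x i 0)) p = real_complex R (peval p x).
Proof. by rewrite /peval mmap_real_points. Qed.

Lemma continuous_line_poly_real (R : realType) (d : nat) (p : mpoly.mpoly d R)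
    (e : 'cV[R]_d) (k : nat) :
  continuous (fun x : 'cV[R]_d => (line_poly (real_complex R)
    (fun i => real_complex R (x i 0)) (fun i => real_complex R (e i 0)) p)`_k
    : (complex R)^o).
Proof.
apply: continuous_coef_line_poly => i; last exact: cst_continuous.
move=> x; apply: (@continuous_comp _ _ _ (fun x : 'cV[R]_d => x i 0)).
  exact: coord_continuous.
exact: continuous_real_complex.
Qed.

(** The base point moves through the cone. A root on the imaginary axis would be real by
    hyperbolicity, hence 0, but [p] is positive on the cone; and at [e] itself the polynomial is
    [(1 + s) ^+ n * p e]. *)
Lemma open_cone_root_free (R : realType) (d n : nat) (p : mpoly.mpoly d R)
    (e y : 'cV[R]_d) (s : complex R) :
  p \is mpoly.ishomog1 n mpoly.mdeg -> hyperbolic p e -> open_cone (peval p) e y ->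
  0 <= complex.Re s -> peval_line p y e s != 0.
Proof.
move=> hp [pe hyp] Dy s0; rewrite peval_line_horner.
pose P := fun x : 'cV[R]_d => line_poly (real_complex R)
    (fun i => real_complex R (x i 0)) (fun i => real_complex R (e i 0)) p.
apply: (@half_plane_root_free R _ (open_cone (peval p) e) P n (real_complex R (peval p e)) e)
  => //.
- exact: component_connected.
- exact: connected_component_refl.
- by rewrite fmorph_eq0 gt_eqF.
- by move=> x; have [] := line_poly_top (real_complex R)
    (fun i => real_complex R (x i 0)) (fun i => real_complex R (e i 0)) hp.
- move=> x; have [_] := line_poly_top (real_complex R)
    (fun i => real_complex R (x i 0)) (fun i => real_complex R (e i 0)) hp.
  by rewrite peval_real_complex.
- exact: continuous_line_poly_real.
- move=> x t /connected_component_sub /= px tre; apply/negP; rewrite -peval_line_horner.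
  move=> /eqP px0; have tim := hyp _ _ px0.
  have t0 : t = 0 by case: t tre tim {px0} => a b /= -> ->.
  move: px0; rewrite /peval_line t0.
  under [fun i => _]funext => i do rewrite mul0r addr0.
  by rewrite peval_real_complex => /eqP; rewrite fmorph_eq0 gt_eqF.
- move=> t t0; rewrite -peval_line_horner /peval_line.
  under [fun i => _]funext => i do rewrite -{1}[real_complex R _]mul1r -mulrDl.
  rewrite (mmap_homog _ _ _ hp) mulf_eq0 negb_or peval_real_complex fmorph_eq0.
  rewrite [_ == 0 in X in _ && X]gt_eqF // andbT; apply: expf_neq0.
  by case: t t0 => a b /= a0; rewrite eq_complex negb_and /= gt_eqF // ltr_wpDr.
Qed.

(** The finitely many roots have negative real part, and subtracting [eps *: e] moves them to the
    right by [eps], so a small [eps] leaves them on the left. *)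
Lemma open_cone_shift_root_free (R : realType) (d n : nat) (p : mpoly.mpoly d R)
    (e y : 'cV[R]_d) :
  p \is mpoly.ishomog1 n mpoly.mdeg -> hyperbolic p e -> open_cone (peval p) e y ->
  exists2 eps : R, 0 < eps &
    forall s, 0 <= complex.Re s -> peval_line p (y - eps *: e) e s != 0.
Proof.
move=> hp he Dy; have [sz top] := line_poly_top (real_complex R)
    (fun i => real_complex R (y i 0)) (fun i => real_complex R (e i 0)) hp.
have pe : real_complex R (peval p e) != 0 by rewrite fmorph_eq0 gt_eqF //; case: he.
move: top; rewrite peval_real_complex => top.
have [|rs _ Prs] := poly_prod_roots sz; first by rewrite top.
have {}Prs z : (peval_line p y e z == 0) = (z \in rs).
  rewrite peval_line_horner Prs top hornerZ mulf_eq0 (negbTE pe) /=.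
  by rewrite -rootE root_prod_XsubC.
have : forall r, r \in rs -> complex.Re r < 0.
  move=> r; rewrite -Prs ltNge; apply: contraL => r0.
  exact: (open_cone_root_free hp he).
have shift eps z : peval_line p (y - eps *: e) e z = peval_line p y e (z - eps%:C%C).
  congr (mpoly.mmap _ _ p); apply/funext => i.
  by rewrite !mxE rmorphB rmorphM mulrBl addrAC addrA.
move=> rs0; suff [eps eps0 heps] : exists2 eps : R, 0 < eps &
    forall r, r \in rs -> complex.Re r < - eps.
  exists eps => // s s0; rewrite shift Prs; apply/negP => /heps.
  by case: s s0 => a b /= a0; rewrite ltrBlDr addNr ltNge a0.
elim: rs rs0 {Prs} => [|r rs IH] rs0; first by exists 1.
have [|eps eps0 heps] := IH; first by move=> r' r'rs; apply: rs0; rewrite inE r'rs orbT.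
have r0 := rs0 r (mem_head _ _).
pose t : R := - complex.Re r / 2.
have t0 : 0 < t by rewrite divr_gt0 // oppr_gt0.
have rt : complex.Re r < - t by rewrite /t mulNr opprK; move: r0; lra.
have [le|lt] := lerP eps t; [exists eps | exists t] => // r'; rewrite inE.
  by move=> /orP[/eqP->|/heps //]; apply: lt_le_trans rt _; rewrite lerN2.
by move=> /orP[/eqP-> //|/heps /lt_trans]; apply; rewrite ltrN2.
Qed.

(* Write [a = a' + eps e] with [a'] still in the cone, and move [beta] from [0] to [1]
   in [v |-> p (beta y + ii (eps e + v a'))].  On the imaginary axis this polynomial
   is [p] at a real point plus [ii eps e], which is nonzero by hyperbolicity along
   [e]; at [beta = 0] its roots have negative real part.  So it has no root with
   [Re v >= 0], and [v = 1], [beta = 1] gives [p (y + ii a) != 0] for all real [y]. *)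
Theorem garding_hyperbolic (R : realType) (d n : nat) (p : mpoly.mpoly d R)
    (e a : 'cV[R]_d) :
  p \is mpoly.ishomog1 n mpoly.mdeg -> hyperbolic p e -> open_cone (peval p) e a ->
  hyperbolic p a.
Proof.
move=> hp he Da; split; first exact: connected_component_sub Da.
have [eps eps0 heps] := open_cone_shift_root_free hp he Da.
set a' := a - eps *: e in heps.
have [pe hyp] := he.
move=> x z pxz; apply/eqP/negP => /negP v0.
pose ii : complex R := Complex 0 1.
have ii0 : ii != 0 by rewrite eq_complex /= negb_and oner_eq0 orbT.
have ii2 : ii * ii = -1 by apply/eqP; rewrite eq_complex /=; apply/andP; split; apply/eqP; ring.
have zE : z = (complex.Re z)%:C%C + ii * (complex.Im z)%:C%C.
  by case: (z) => s t; apply/eqP; rewrite eq_complex /=; apply/andP; split; apply/eqP; ring.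
(* Chosen so that [x + z a = Im z (y + ii a)]: by homogeneity it suffices to exclude a zero at
   [y + ii a]. *)
pose y := (complex.Im z)^-1 *: (x + complex.Re z *: a).
pose u (beta : R) (i : 'I_d) : complex R := (beta * y i 0)%:C%C + ii * (eps * e i 0)%:C%C.
pose w (i : 'I_d) : complex R := ii * (a' i 0)%:C%C.
pose F beta := line_poly (real_complex R) (u beta) w p.
have mxl s t (B1 B2 : 'cV[R]_d) i : (s *: B1 - t *: B2) i 0 = s * B1 i 0 - t * B2 i 0.
  by rewrite !mxE.
have pa' : peval p a' != 0.
  have := heps 0 (lexx _); rewrite /peval_line.
  under [fun i => _]funext => i do rewrite mul0r addr0.
  by rewrite peval_real_complex fmorph_eq0.
have szF beta : (size (F beta) <= n.+1)%N.
  by have [] := line_poly_top (real_complex R) (u beta) w hp.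
have topF beta : (F beta)`_n = ii ^+ n * (peval p a')%:C%C.
  have [_] := line_poly_top (real_complex R) (u beta) w hp; rewrite -/(F beta) => ->.
  by rewrite (mmap_homog _ _ _ hp) peval_real_complex.
have : (F 1).[1] != 0.
  apply: (@half_plane_root_free R _ setT F n (ii ^+ n * (peval p a')%:C%C) 0) => //.
  - by apply/connected_intervalP => s t _ _ r _.
  - by rewrite mulf_neq0 ?expf_neq0 // fmorph_eq0.
  - move=> k; apply: (@continuous_coef_line_poly _ _ _ _ _ u (fun=> w)) => i; last first.
      exact: cst_continuous.
    move=> s; apply: cvgD; last exact: cvg_cst.
    apply: (@continuous_comp _ _ _ (fun s : R => s * y i 0)).
      exact: mulrr_continuous.
    exact: continuous_real_complex.
  - move=> s v _ rev; rewrite horner_line_poly.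
    have -> : v = ii * (complex.Im v)%:C%C.
      case: v rev => v1 v2 /= ->.
      by apply/eqP; rewrite eq_complex /=; apply/andP; split; apply/eqP; ring.
    apply/negP => /eqP pF.
    have : peval_line p (s *: y - complex.Im v *: a') e (ii * eps%:C%C) = 0.
      rewrite -pF; congr (mpoly.mmap _ _ p); apply/funext => i; rewrite mxl /u /w.
      by rewrite mulrACA ii2 rmorphB !rmorphM /=; ring.
    by move/hyp => /=; rewrite mul0r mul1r add0r => eps00; rewrite eps00 ltxx in eps0.
  - move=> v rev; rewrite horner_line_poly.
    have -> : (fun i => u 0 i + v * w i) =
        (fun i => ii * ((eps * e i 0)%:C%C + v * (a' i 0)%:C%C)).
      by apply/funext => i; rewrite /u /w mul0r rmorph0; ring.
    rewrite (mmap_homog _ _ _ hp) mulf_neq0 ?expf_neq0 //.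
    have [->|vn0] := eqVneq v 0.
      under [fun i => _]funext => i do rewrite mul0r addr0 rmorphM.
      rewrite (mmap_homog _ _ _ hp) peval_real_complex.
      by rewrite mulf_neq0 ?expf_neq0 ?fmorph_eq0 ?gt_eqF.
    (* Factoring out [v] brings the point to the form treated by [heps], since [eps / v] has
       nonnegative real part when [v] does. *)
    have -> : (fun i => (eps * e i 0)%:C%C + v * (a' i 0)%:C%C) =
        (fun i => v * ((a' i 0)%:C%C + (eps%:C%C / v) * (e i 0)%:C%C)).
      by apply/funext => i; rewrite rmorphM /=; field.
    rewrite (mmap_homog _ _ _ hp) mulf_neq0 ?expf_neq0 //; apply: heps.
    case: v rev {vn0} => v1 v2 /= v10; rewrite mul0r subr0.
    by rewrite mulr_ge0 ?(ltW eps0) // divr_ge0 // addr_ge0 // sqr_ge0.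
apply/negP; rewrite negbK; have imz : (complex.Im z)%:C%C != 0 :> complex R.
  by rewrite fmorph_eq0.
rewrite horner_line_poly -(inj_eq (mulfI (expf_neq0 n imz))) mulr0 -(mmap_homog _ _ _ hp).
rewrite -pxz; apply/eqP; congr (mpoly.mmap _ _ p); apply/funext => i.
rewrite /u /w [in RHS]zE /y /a' !mxE !rmorphB !rmorphM !rmorphD !rmorphM fmorphV.
by rewrite /=; field.
Qed.

(** * First and second derivatives along a hyperbolic direction *)

Definition coords {R : realType} {d : nat} (x : 'cV[R]_d) : 'I_d -> R := fun i => x i 0.

Definition grad_at {R : realType} {d : nat} (p : mpoly.mpoly d R) (e x : 'cV[R]_d) : R :=
  peval (dir_deriv (coords x) p) e.

Definition hess_at {R : realType} {d : nat} (p : mpoly.mpoly d R) (e x y : 'cV[R]_d) : R :=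
  peval (dir_deriv (coords x) (dir_deriv (coords y) p)) e.

Section Forms.
Variables (R : realType) (d : nat) (p : mpoly.mpoly d R) (e : 'cV[R]_d).

Lemma grad_at_lin (a : R) (x y : 'cV[R]_d) :
  grad_at p e (a *: x + y) = a * grad_at p e x + grad_at p e y.
Proof.
rewrite /grad_at /peval !meval_dir_deriv mulr_sumr -big_split; apply: eq_bigr => i _ /=.
by rewrite /coords !mxE mulrDl mulrA.
Qed.

Lemma grad_atN (x : 'cV[R]_d) : grad_at p e (- x) = - grad_at p e x.
Proof.
rewrite /grad_at /peval !meval_dir_deriv -sumrN; apply: eq_bigr => i _ /=.
by rewrite /coords !mxE mulNr.
Qed.

Lemma hess_at_sym (x y : 'cV[R]_d) : hess_at p e x y = hess_at p e y x.
Proof. by rewrite /hess_at dir_deriv_sym. Qed.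

Lemma hess_at_linl (a : R) (x y z : 'cV[R]_d) :
  hess_at p e (a *: x + y) z = a * hess_at p e x z + hess_at p e y z.
Proof.
rewrite /hess_at /peval !meval_dir_deriv mulr_sumr -big_split; apply: eq_bigr => i _ /=.
by rewrite /coords !mxE mulrDl mulrA.
Qed.

Lemma hess_at_linr (a : R) (x y z : 'cV[R]_d) :
  hess_at p e z (a *: x + y) = a * hess_at p e z x + hess_at p e z y.
Proof. by rewrite !(hess_at_sym z) hess_at_linl. Qed.

Lemma hess_atZl (a : R) (x y : 'cV[R]_d) : hess_at p e (a *: x) y = a * hess_at p e x y.
Proof.
rewrite /hess_at /peval !meval_dir_deriv mulr_sumr; apply: eq_bigr => i _ /=.
by rewrite /coords !mxE mulrA.
Qed.

Lemma hess_atZr (a : R) (x y : 'cV[R]_d) : hess_at p e x (a *: y) = a * hess_at p e x y.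
Proof. by rewrite !(hess_at_sym x) hess_atZl. Qed.

Lemma hess_at_quad (a : R) (x y : 'cV[R]_d) :
  hess_at p e (a *: x + y) (a *: x + y) =
  a ^+ 2 * hess_at p e x x + a * hess_at p e x y *+ 2 + hess_at p e y y.
Proof. by rewrite hess_at_linl !hess_at_linr (hess_at_sym y x); ring. Qed.

Variable n : nat.
Hypothesis hp : p \is mpoly.ishomog1 n mpoly.mdeg.

Lemma grad_at_self : grad_at p e e = n%:R * peval p e.
Proof. exact: euler_meval. Qed.

Lemma hess_at_self (x : 'cV[R]_d) : hess_at p e x e = (n%:R - 1) * grad_at p e x.
Proof. by rewrite hess_at_sym; apply: euler_meval2. Qed.

End Forms.

Lemma coef_prod_affine (R : realType) (ls : seq R) :
  let P := \prod_(l <- ls) (1 + l *: 'X) in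
  [/\ P`_0 = 1, P`_1 = \sum_(l <- ls) l &
    P`_2 *+ 2 = (\sum_(l <- ls) l) ^+ 2 - \sum_(l <- ls) l ^+ 2].
Proof.
elim: ls => [|l ls [IH0 IH1 IH2]]; first by rewrite /= !big_nil !coef1 expr0n subr0 mul0rn.
rewrite /= !big_cons; set P := \prod_(l <- ls) _ in IH0 IH1 IH2 *.
rewrite mulrDl mul1r -scalerAl !coefD !coefZ !coefXM /= IH0 IH1.
split; [ring | ring |].
by rewrite mulrnDl IH2; ring.
Qed.

Lemma sqr_sum_le (R : realType) (ls : seq R) :
  (\sum_(l <- ls) l) ^+ 2 <= (size ls)%:R * \sum_(l <- ls) l ^+ 2.
Proof.
elim: ls => [|l ls IH]; first by rewrite !big_nil expr0n mul0r.
rewrite !big_cons /= -natr1; set S := \sum_(l <- ls) l in IH *.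
set Q := \sum_(l <- ls) _ in IH *.
have Q0 : 0 <= Q by apply: sumr_ge0 => i _; apply: sqr_ge0.
move: (ler0n R (size ls)) IH; move: (size ls)%:R Q0 S => K Q0 S.
move: Q Q0 => Q Q0; rewrite le_eqVlt => /predU1P[<- | K0] IH.
  have /eqP : S ^+ 2 = 0 by apply/eqP; rewrite eq_le sqr_ge0 andbT -(mul0r Q).
  by rewrite sqrf_eq0 => /eqP ->; nra.
(* [K (K l^2 - 2 l S + Q) = (K l - S)^2 + (K Q - S^2)]. *)
have := sqr_ge0 (K * l - S) => h.
have : 0 <= K * (K * l ^+ 2 - 2 * l * S + Q) by nra.
by rewrite pmulr_rge0 //; nra.
Qed.

Lemma ln_prod_le (R : realType) (ls : seq R) : (forall l, l \in ls -> 0 < 1 + l) ->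
  0 < \prod_(l <- ls) (1 + l) /\ ln (\prod_(l <- ls) (1 + l)) <= \sum_(l <- ls) l.
Proof.
elim: ls => [|l ls IH] hls; first by rewrite !big_nil ln1.
have [|P0 Pln] := IH; first by move=> l' l'ls; apply: hls; rewrite inE l'ls orbT.
have l0 := hls l (mem_head _ _).
rewrite !big_cons; split; first exact: mulr_gt0.
rewrite lnM ?posrE //; apply: lerD => //.
by apply: le_ln1Dx; move: l0; lra.
Qed.

Section Hyperbolic.
Variables (R : realType) (d n : nat) (p : mpoly.mpoly d R) (e : 'cV[R]_d).
Hypothesis hp : p \is mpoly.ishomog1 n mpoly.mdeg.
Hypothesis he : hyperbolic p e.

(** A root [z] is nonzero because [p e > 0], and [p (e + z x) = z^n p (x + z^-1 e)], so
    hyperbolicity makes [z^-1] real. The [l] are the opposites of the inverse roots; there are fewer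
    than [n] of them when [p x = 0]. *)
Lemma line_poly_real_factor (x : 'cV[R]_d) :
  exists2 ls : seq R, (size ls <= n)%N &
    line_poly idfun (coords e) (coords x) p = peval p e *: \prod_(l <- ls) (1 + l *: 'X).
Proof.
have [pe hyp] := he.
set G := line_poly _ _ _ _.
have mapG : map_poly (real_complex R) G =
    line_poly (real_complex R) (fun i => (e i 0)%:C%C) (fun i => (x i 0)%:C%C) p.
  exact: map_line_poly.
have G0 : (map_poly (real_complex R) G).[0] = (peval p e)%:C%C.
  rewrite mapG -peval_line_horner /peval_line.
  under [fun i => _]funext => i do rewrite mul0r addr0.
  exact: peval_real_complex.
have rootG z : (map_poly (real_complex R) G).[z] = 0 -> z != 0 /\ z = (complex.Re z)%:C%C.
  move=> Gz; have z0 : z != 0.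
    by apply: contra_eq_neq Gz => ->; rewrite G0 fmorph_eq0 gt_eqF.
  split=> //; suff : complex.Im z = 0 by case: (z) => a b /= ->.
  have : complex.Im z^-1 = 0.
    apply: (hyp x); apply: (mulfI (expf_neq0 n z0)).
    rewrite mulr0 /peval_line -(mmap_homog _ _ _ hp) -Gz mapG horner_line_poly.
    congr (mpoly.mmap _ _ p); apply/funext => i.
    by rewrite mulrDr mulrA divff // mul1r addrC.
  case: z z0 {Gz} => a b; rewrite eq_complex negb_and /= => ab0 /eqP.
  rewrite oppr_eq0 mulf_eq0 invr_eq0 => /orP[/eqP //|].
  by rewrite paddr_eq0 ?sqr_ge0 // !sqrf_eq0 => /andP[/eqP a0 /eqP].
have [rs Grs] := closed_field_poly_normal (map_poly (real_complex R) G).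
set lc := lead_coef _ in Grs.
have lc0 : lc != 0.
  apply/eqP => lc0; move: G0; rewrite Grs lc0 scale0r horner0 => /esym/eqP.
  by rewrite fmorph_eq0 gt_eqF.
have rsG r : r \in rs -> r != 0 /\ r = (complex.Re r)%:C%C.
  by move=> rrs; apply: rootG; rewrite Grs hornerZ (rootP _) ?mulr0 // root_prod_XsubC.
exists [seq - (complex.Re r)^-1 | r <- rs].
  rewrite size_map; have [sz _] := line_poly_top idfun (coords e) (coords x) hp.
  have := size_prod_XsubC rs id; rewrite -(size_scale _ lc0) -Grs size_map_poly -ltnS => <-.
  exact: sz.
apply: (map_poly_inj (real_complex R)).
have prodE : \prod_(r <- rs) ('X - r%:P) =
    (\prod_(r <- rs) - r) *: map_poly (real_complex R)
      (\prod_(l <- [seq - (complex.Re r)^-1 | r <- rs]) (1 + l *: 'X)).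
  rewrite big_map rmorph_prod -scaler_prod; apply: eq_big_seq => r /rsG[r0 rE].
  rewrite rmorphD rmorph1 /= map_polyZ map_polyX /= rmorphN fmorphV /= -rE.
  by rewrite scalerDr scalerA mulrNN divff // scale1r addrC -alg_polyC scaleNr.
have lcE : lc * \prod_(r <- rs) - r = (peval p e)%:C%C.
  rewrite -G0 Grs hornerZ horner_prod; congr (_ * _); apply: eq_bigr => r _.
  by rewrite hornerXsubC sub0r.
by rewrite Grs prodE scalerA lcE map_polyZ.
Qed.

(* Newton's inequality for the coefficients of a real-rooted polynomial, read as a
   reverse Cauchy-Schwarz inequality: the Hessian of [p] at [e] is Lorentzian. *)
Lemma hess_newton (x : 'cV[R]_d) : (0 < n)%N ->
  hess_at p e x x * hess_at p e e e <= hess_at p e x e ^+ 2.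
Proof.
move=> n0; have [ls sz Gls] := line_poly_real_factor x.
have [_ c1 c2] := coef_prod_affine ls.
have D1 : grad_at p e x = peval p e * \sum_(l <- ls) l.
  by rewrite -c1 -coefZ -Gls -[LHS](coef_line_poly (coords e) (coords x) p 1).
have D2 : hess_at p e x x =
    peval p e * ((\sum_(l <- ls) l) ^+ 2 - \sum_(l <- ls) l ^+ 2).
  by rewrite -c2 mulrnAr -coefZ -Gls -[LHS](coef_line_poly (coords e) (coords x) p 2).
have pe : 0 < peval p e by case: he.
have := sqr_sum_le ls; rewrite !(hess_at_self _ hp) (grad_at_self _ hp) D1 D2.
set S := \sum_(l <- ls) l; set Q := \sum_(l <- ls) _ => SQ.
have Q0 : 0 <= Q by apply: sumr_ge0 => i _; apply: sqr_ge0.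
have {}SQ : S ^+ 2 <= n%:R * Q by apply: le_trans SQ _; rewrite ler_wpM2r // ler_nat.
have N1 : 0 <= n%:R - 1 :> R by rewrite subr_ge0 ler1n.
move: (peval p e) pe (n%:R : R) N1 SQ => P P0 N N1 SQ.
rewrite -subr_ge0 (_ : _ - _ = (N - 1) * P ^+ 2 * (N * Q - S ^+ 2)); last by ring.
by rewrite mulr_ge0 ?subr_ge0 // mulr_ge0 // sqr_ge0.
Qed.

(* The second hypothesis turns [p (e + t (y - e)) = p e * \prod (1 + t l)] into
   [1 + l > 0] for every factor, and then [ln (1 + l) <= l]. *)
Lemma ln_le_tangent (y : 'cV[R]_d) :
  0 < peval p y ->
  (forall s : R, 0 <= s -> peval p (y + s *: e) != 0) ->
  ln (peval p y) <= ln (peval p e) + grad_at p e (y - e) / peval p e.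
Proof.
move=> py yfree; have pe : 0 < peval p e by case: he.
have [ls _ Gls] := line_poly_real_factor (y - e).
have [_ c1 _] := coef_prod_affine ls.
have D1 : grad_at p e (y - e) = peval p e * \sum_(l <- ls) l.
  by rewrite -c1 -coefZ -Gls -[LHS](coef_line_poly (coords e) (coords (y - e)) p 1).
have val t : peval p (e + t *: (y - e)) = peval p e * \prod_(l <- ls) (1 + t * l).
  have -> : peval p (e + t *: (y - e)) = (line_poly idfun (coords e) (coords (y - e)) p).[t].
    by rewrite horner_line_poly; apply: mpoly.meval_eq => i; rewrite /coords !mxE.
  rewrite Gls hornerZ horner_prod; congr (_ * _); apply: eq_bigr => l _.
  by rewrite !hornerE mulrC.
have [|P0 Pln] := @ln_prod_le _ ls.
  move=> l lls; rewrite ltNge; apply/negP => l1.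
  have l0 : l < 0 by move: l1; lra.
  (* The factor of [l] vanishes at this [t], which lies in [(0, 1]]; there [e + t (y - e)] is a
     positive multiple of [y + (t^-1 - 1) e], where [yfree] forbids a zero. *)
  pose t := - l^-1.
  have t0 : 0 < t by rewrite oppr_gt0 invr_lt0.
  have t1 : 0 <= t^-1 - 1 by rewrite /t invrN invrK; move: l1; lra.
  have := yfree _ t1; apply/negP; rewrite negbK.
  have -> : y + (t^-1 - 1) *: e = t^-1 *: (e + t *: (y - e)).
    rewrite scalerDr scalerA mulVf ?gt_eqF // scale1r scalerBl scale1r.
    by rewrite addrC addrAC -addrA.
  have -> : peval p (t^-1 *: (e + t *: (y - e))) = t^-1 ^+ n * peval p (e + t *: (y - e)).
    rewrite -(mmap_homog _ _ _ hp); apply: mpoly.meval_eq => i.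
    by rewrite !mxE.
  have tl : 1 + t * l = 0 by rewrite /t mulNr mulVf ?lt_eqF // subrr.
  by rewrite val (big_rem l) //= tl mul0r !mulr0.
have := val 1; rewrite scale1r addrC subrK => ->.
under eq_bigr => l _ do rewrite mul1r.
by rewrite lnM ?posrE // lerD2l D1 mulrAC mulfV ?gt_eqF // mul1r.
Qed.

End Hyperbolic.

(** * Analytic derivatives and continuity of polynomial maps *)

Lemma is_derive_meval (R : realType) (d : nat) (gam : R -> 'I_d -> R) (t : R)
    (del : 'I_d -> R) (q : mpoly.mpoly d R) :
  (forall i, is_derive t 1 (fun s => gam s i) (del i)) ->
  is_derive t 1 (fun s => mpoly.meval (gam s) q) (mpoly.meval (gam t) (dir_deriv del q)).
Proof.
move=> dgam; elim/mpoly_alg_ind: q => [c|i|q r Hq Hr|q r Hq Hr].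
- rewrite dir_derivC raddf0 (_ : (fun _ => _) = cst c); first exact: is_derive_cst.
  by apply/funext => s; rewrite mpoly.mevalC.
- rewrite dir_derivX mpoly.mevalC; under eq_fun => s do rewrite mpoly.mevalXU.
  exact: dgam.
- rewrite dir_derivD mpoly.mevalD; under eq_fun => s do rewrite mpoly.mevalD.
  exact: is_deriveD.
- rewrite dir_derivM mpoly.mevalD !mpoly.mevalM; under eq_fun => s do rewrite mpoly.mevalM.
  apply: is_derive_eq (is_deriveM Hq Hr) _.
  by rewrite addrC mulrC.
Qed.

Lemma cvg_meval (R : realType) (d : nat) (T : Type) (F : set_system T)
    (FF : Filter F) (gam : T -> 'I_d -> R) (a : 'I_d -> R) (q : mpoly.mpoly d R) :
  (forall i, gam s i @[s --> F] --> a i) ->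
  mpoly.meval (gam s) q @[s --> F] --> mpoly.meval a q.
Proof.
move=> cgam; elim/mpoly_alg_ind: q => [c|i|q r Hq Hr|q r Hq Hr].
- rewrite mpoly.mevalC; under eq_fun => s do rewrite mpoly.mevalC.
  exact: cvg_cst.
- rewrite mpoly.mevalXU; under eq_fun => s do rewrite mpoly.mevalXU.
  exact: cgam.
- rewrite mpoly.mevalD; under eq_fun => s do rewrite mpoly.mevalD.
  exact: cvgD.
- rewrite mpoly.mevalM; under eq_fun => s do rewrite mpoly.mevalM.
  exact: cvgM.
Qed.

Lemma continuous_peval (R : realType) (d : nat) (q : mpoly.mpoly d R) : continuous (peval q).
Proof.
move=> x; apply: (@cvg_meval _ _ _ (nbhs x) _ (fun y i => y i 0)) => i.
exact: coord_continuous.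
Qed.

Lemma is_derive_peval_line (R : realType) (d : nat) (p : mpoly.mpoly d R)
    (z v : 'cV[R]_d) (t : R) :
  is_derive t 1 (fun s => peval p (z + s *: v)) (grad_at p (z + t *: v) v).
Proof.
apply: is_derive_meval => i.
rewrite (_ : (fun _ => _) = cst (z i 0) + (v i 0 \*: (@id R))); last first.
  by apply/funext => s; rewrite !mxE mulrC.
by apply: is_derive_eq; rewrite add0r [_ *: _]mulr1.
Qed.

(** Passes from the analytic derivatives in [pder] to formal ones, for which symmetry and Euler's
    identities are available. *)
Lemma derive_peval (R : realType) (d : nat) (q : mpoly.mpoly d R) (v : 'cV[R]_d) :
  'D_v (peval q) = peval (dir_deriv (coords v) q).
Proof.
apply/funext => x.
pose g (s : R) := peval q (x + s *: v).
have dg := is_derive_peval_line q x v 0.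
transitivity ('D_1 g (0 : R)); last by rewrite derive_val /grad_at scale0r addr0.
have E : (fun h : R => h^-1 *: ((peval q \o shift x) (h *: v) - peval q x)) =
    (fun h : R => h^-1 *: ((g \o shift (0 : R)) (h *: (1 : R)) - g 0)).
  apply/funext => h; rewrite /g /= addr0 scale0r addr0 [_%:A]mulr1.
  by rewrite [h *: v + x]addrC.
by rewrite /derive E.
Qed.

Lemma pderE (R : realType) (d : nat) (p : mpoly.mpoly d R) (v : 'cV[R]_d) (k : nat) :
  pder p v k = peval (iter k (dir_deriv (coords v)) p).
Proof. by elim: k => // k IH; rewrite /pder iterS -/(pder p v k) IH derive_peval. Qed.

(** By [line_poly_rev], coefficient [n - 2] of [p (x + t v)] is coefficient 2 of [p (v + t x)]; the
    factorials of the two Taylor formulas leave the constant. *)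
Lemma pder_quadratic (R : realType) (d n : nat) (p : mpoly.mpoly d R) (v x : 'cV[R]_d) :
  p \is mpoly.ishomog1 n mpoly.mdeg -> (2 <= n)%N ->
  pder p v (n - 2) x = (n - 2)`!%:R / 2 * hess_at p v x x.
Proof.
move=> hp n2; rewrite pderE.
rewrite -[LHS](coef_line_poly (coords x) (coords v) p (n - 2)).
rewrite (line_poly_rev _ _ hp) ?leq_subr // subKn //.
rewrite -[hess_at p v x x](coef_line_poly (coords v) (coords x) p 2).
by rewrite -[X in _ = _ * X]mulr_natl mulrA divfK ?pnatr_eq0 // mulr_natl.
Qed.

(** * The quadratic relaxation of order [n - 2] *)

Lemma open_positive (R : realType) (T : topologicalType) (f : T -> R) :
  continuous f -> open [set x | 0 < f x].
Proof. by move=> cf; apply: (@open_comp _ _ f [set y | 0 < y]) (@open_gt R 0) => x _. Qed.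

Lemma closed_nonneg (R : realType) (T : topologicalType) (f : T -> R) :
  continuous f -> closed [set x | 0 <= f x].
Proof. by move=> cf; apply: (@closed_comp _ _ f [set y | 0 <= y]) (@closed_ge R 0) => x _. Qed.

Lemma open_cone_segment (R : realType) (d : nat) (q : 'cV[R]_d -> R) (e y w : 'cV[R]_d) :
  open_cone q e y -> (forall t, 0 <= t <= 1 -> 0 < q (y + t *: w)) ->
  open_cone q e (y + w).
Proof.
move=> Dy qpos; apply: connected_component_trans Dy _.
exists ((fun t : R => y + t *: w) @` `[0, 1]); last first.
  by exists 1; rewrite /= ?in_itv /= ?ler01 ?lexx // scale1r.
split.
- by exists 0; rewrite /= ?in_itv /= ?ler01 ?lexx // scale0r addr0.
- by move=> _ [t /= + <-]; rewrite in_itv /=; apply: qpos.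
- apply: connected_continuous_connected; first exact: segment_connected.
  apply: continuous_subspaceT => t; apply: cvgD; first exact: cvg_cst.
  exact: scalel_continuous.
Qed.

Lemma open_cone_sign (R : realType) (d : nat) (q f : 'cV[R]_d -> R) (e x : 'cV[R]_d) :
  continuous f -> 0 < f e -> (forall y, open_cone q e y -> f y != 0) ->
  open_cone q e x -> 0 < f x.
Proof.
move=> cf fe fn0 Dx.
have De : open_cone q e e.
  exact: connected_component_trans Dx (connected_component_sym Dx).
suff E : open_cone q e `&` [set y | 0 < f y] = open_cone q e by move: Dx; rewrite -E => -[].
apply: component_connected.
- by exists e.
- by exists [set y | 0 < f y] => //; apply: open_positive.
- exists [set y | 0 <= f y]; first exact: closed_nonneg.
  apply/seteqP; split=> y [Dy fy]; split=> //=; first exact: ltW.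
  by rewrite lt_neqAle eq_sym fn0.
Qed.

Lemma pos_perturb (R : realFieldType) (k m : R) : 0 < k ->
  exists2 s0 : R, 0 < s0 & forall s, 0 < s <= s0 -> 0 < k + s * m.
Proof.
move=> k0; have m0 : 0 < 1 + `|m| by rewrite ltr_wpDr.
exists (k / (1 + `|m|)); first exact: divr_gt0.
move=> s /andP[s0]; rewrite ler_pdivlMr // => sk.
have : - (s * m) <= s * `|m|.
  by rewrite -mulrN ler_wpM2l ?(ltW s0) // -normrN ler_norm.
by lra.
Qed.

Section QuadraticProgram.
Variables (R : realType) (d m n : nat) (p : mpoly.mpoly d R) (e : 'cV[R]_d).
Hypothesis n2 : (2 <= n)%N.
Hypothesis hp : p \is mpoly.ishomog1 n mpoly.mdeg.
Hypothesis he : hyperbolic p e.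

Local Notation h := (hess_at p e).

Let hee : 0 < h e e.
Proof.
rewrite (hess_at_self _ hp) (grad_at_self _ hp) !mulr_gt0 ?subr_gt0 ?ltr1n //.
  by rewrite ltr0n (ltn_trans _ n2).
by case: he.
Qed.

Let newton x : h x x * h e e <= h x e ^+ 2.
Proof. by apply: (hess_newton hp he); apply: ltn_trans n2. Qed.

Let pder_gt0 x : (0 < pder p e (n - 2) x) = (0 < h x x).
Proof. by rewrite (pder_quadratic _ _ hp) // pmulr_rgt0 // divr_gt0 ?ltr0n ?fact_gt0. Qed.

Lemma continuous_hess_atl y : continuous (fun x => h x y).
Proof.
rewrite /hess_at /peval; under eq_fun => x do rewrite meval_dir_deriv.
apply: continuous_big => [|i _]; first exact: add_continuous.
move=> x; apply: (@continuousM _ _ (fun x : 'cV[R]_d => x i 0) (cst _)).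
  exact: coord_continuous.
exact: cst_continuous.
Qed.

(** By [newton], [h y e] cannot vanish where [h y y > 0], so on the connected cone it keeps the sign
    it has at [e]. *)
Lemma quadratic_cone_sub (x : 'cV[R]_d) :
  open_cone (pder p e (n - 2)) e x -> 0 < h x x /\ 0 < h x e.
Proof.
move=> Dx; split; first by rewrite -pder_gt0; apply: connected_component_sub Dx.
apply: (@open_cone_sign _ _ _ (fun x => h x e) _ _ _ hee _ Dx).
  exact: continuous_hess_atl.
move=> y /connected_component_sub /=; rewrite pder_gt0 => hyy.
apply/eqP => hye; have := newton y; rewrite hye expr0n leNgt.
by rewrite mulr_gt0.
Qed.

(** On the segment from [e] to [x] the quadratic form expands into nonnegative multiples of [h x x],
    [h x e] and [h e e], so the segment never leaves the positivity set. *)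
Lemma quadratic_cone_sup (x : 'cV[R]_d) :
  0 < h x x -> 0 < h x e -> open_cone (pder p e (n - 2)) e x.
Proof.
move=> hxx hxe; rewrite -(subrK e x) addrC; apply: open_cone_segment.
  by apply: connected_component_refl; rewrite /= pder_gt0.
move=> t /andP[t0 t1]; rewrite pder_gt0.
have -> : e + t *: (x - e) = t *: x + (1 - t) *: e.
  by rewrite scalerBr scalerBl scale1r addrCA.
rewrite hess_at_quad !hess_atZr hess_atZl.
have t2 : 0 <= t ^+ 2 * h x x by rewrite mulr_ge0 ?sqr_ge0 // ltW.
have u0 : 0 <= 1 - t by rewrite subr_ge0.
have tu : 0 <= t * ((1 - t) * h x e) *+ 2 by rewrite mulrn_wge0 // !mulr_ge0 // ltW.
have [t1'|t1'] := ltrP t 1.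
  have u1 : 0 < 1 - t by rewrite subr_gt0.
  by apply: ltr_wpDl; [exact: addr_ge0 | rewrite !pmulr_rgt0].
have -> : t = 1 by apply/eqP; rewrite eq_le t1.
by rewrite subrr !mul0r mulr0 mul0rn !addr0 expr1n mul1r.
Qed.

Lemma quadratic_cone_closed (x : 'cV[R]_d) :
  closed_cone (pder p e (n - 2)) e x -> 0 <= h x x /\ 0 <= h x e.
Proof.
have sub : open_cone (pder p e (n - 2)) e `<=`
    [set y | 0 <= pder p e (n - 2) y] `&` [set y | 0 <= h y e].
  move=> y Dy; have [_ hye] := quadratic_cone_sub Dy.
  by split; apply: ltW => //; apply: connected_component_sub Dy.
have /closure_id clE : closed ([set y | 0 <= pder p e (n - 2) y] `&` [set y | 0 <= h y e]).
  apply: closedI; apply: closed_nonneg; last exact: continuous_hess_atl.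
  by rewrite pderE; exact: continuous_peval.
move=> /(closure_subset sub); rewrite -clE => -[/= qx hxe].
split=> //; rewrite leNgt; apply/negP => hxx; move: qx.
rewrite (pder_quadratic _ _ hp) // pmulr_rge0 ?divr_gt0 ?ltr0n ?fact_gt0 //.
by rewrite leNgt hxx.
Qed.

Variables (A : {linear 'cV[R]_d -> 'cV[R]_m}) (b : 'cV[R]_m).
Variables (c : {linear 'cV[R]_d -> R^o}) (x : 'cV[R]_d).
Hypothesis x_opt : optimal_set A b c (closed_cone (pder p e (n - 2)) e) x.

(* If [h x e = 0] then [x] lies in the radical of [h], so [h x v > 0] is impossible;
   otherwise [x + s v] is interior to the cone for small [s > 0]. *)
Lemma optimal_direction (v : 'cV[R]_d) : A v = 0 -> 0 < h x v -> 0 <= (c v : R).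
Proof.
move=> Av hxv; have [Ax Kx xmin] := x_opt.
have [hxx hxe] := quadratic_cone_closed Kx.
have {hxe} hxe : 0 < h x e.
  rewrite lt_neqAle hxe andbT eq_sym; apply/eqP => hxe0.
  (* [w] is a multiple of [v] made [h]-orthogonal to [e]. For small [s0 > 0] the vector
     [s0 *: w + x] is still orthogonal to [e] but has a positive square, against [newton]. *)
  pose w := h e e *: v + (- h v e) *: e.
  have hwe : h w e = 0 by rewrite hess_at_linl hess_atZl; ring.
  have hxw : 0 < h x w *+ 2.
    by rewrite hess_at_linr hess_atZr hxe0 mulr0 addr0 mulr2n addr_gt0 // mulr_gt0.
  have [s0 s00 hs0] := pos_perturb (h w w) hxw.
  have {}hs0 := hs0 s0; rewrite s00 lexx in hs0.
  have := newton (s0 *: w + x).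
  rewrite hess_at_quad [h (_ *: w + x) e]hess_at_linl hwe hxe0 mulr0 addr0 expr0n /= pmulr_lle0 //.
  rewrite leNgt (hess_at_sym p e w x) ltr_wpDr // expr2 -mulrA -mulrnAr -mulrDr.
  by rewrite mulr_gt0 // addrC hs0.
have hxv2 : 0 < h x v *+ 2 by rewrite mulrn_wgt0.
have [s1 s10 hs1] := pos_perturb (h v v) hxv2.
have [s2 s20 hs2] := pos_perturb (h v e) hxe.
have [s s0 [le1 le2]] : exists2 s, 0 < s & s <= s1 /\ s <= s2.
  by have [le|lt] := lerP s1 s2; [exists s1 | exists s2] => //; split=> //; apply: ltW.
have Ks : closed_cone (pder p e (n - 2)) e (s *: v + x).
  apply: subset_closure; apply: quadratic_cone_sup; last first.
    by rewrite hess_at_linl addrC hs2 // s0.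
  rewrite hess_at_quad (hess_at_sym p e v x) ltr_wpDr // expr2 -mulrA -mulrnAr -mulrDr.
  by rewrite mulr_gt0 // addrC hs1 // s0.
have := xmin (s *: v + x) _ Ks.
rewrite linearD linearZ /= Av scaler0 add0r => /(_ Ax).
by rewrite linearD linearZ /= lerDr pmulr_rge0.
Qed.

(** If [h x v < 0], then [- v] is an admissible direction, but it does not lower the objective when
    [c v = 0]. Adding a small multiple of [- u] makes the decrease strict and keeps [h x]
    positive. *)
Lemma optimal_gradient (u v : 'cV[R]_d) :
  A u = 0 -> 0 < (c u : R) -> A v = 0 -> 0 <= (c v : R) -> 0 <= h x v.
Proof.
move=> Au cu Av cv; rewrite leNgt; apply/negP => hxv.
have hxv' : 0 < h x (- 1 *: v) by rewrite hess_atZr mulN1r oppr_gt0.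
have [s s0 hs] := pos_perturb (- h x u) hxv'.
have {}hs := hs s; rewrite s0 lexx in hs.
have : 0 <= (c (- s *: u + - 1 *: v) : R).
  apply: optimal_direction; first by rewrite linearD !linearZ /= Au Av !scaler0 addr0.
  by rewrite hess_at_linr mulNr addrC -mulrN hs.
rewrite leNgt linearD !linearZ /= => /negP; apply.
by rewrite !scaleNr scale1r -opprD oppr_lt0 ltr_wpDr // mulr_gt0.
Qed.

End QuadraticProgram.

(** * Central path and trajectory *)

(** Otherwise [c] vanishes on [ker A] and factors through [A]: the composite of [c] with any section
    [g] of [A] is linear, because [g] is linear up to [ker A]. *)
Lemma kernel_direction (R : realType) (d m : nat) (A : {linear 'cV[R]_d -> 'cV[R]_m})
    (c : {linear 'cV[R]_d -> R^o}) :
  (forall y : 'cV[R]_m, exists x : 'cV[R]_d, A x = y) ->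
  ~ (exists y : {linear 'cV[R]_m -> R^o}, forall x, c x = y (A x)) ->
  exists2 u : 'cV[R]_d, A u = 0 & 0 < (c u : R).
Proof.
move=> Asurj cA; apply: contrapT => nou; apply: cA.
have cker u : A u = 0 -> c u = 0.
  move=> Au; apply/eqP; rewrite eq_le !leNgt; apply/andP; split; apply/negP => cu.
    by apply: nou; exists u.
  by apply: nou; exists (- u); rewrite linearN /= ?Au ?oppr0 // oppr_gt0.
have [g gK] := choice Asurj.
have lin : linear (fun y => c (g y) : R^o).
  move=> k y z; apply/eqP; rewrite -subr_eq0 -linearZ -linearD -linearB; apply/eqP/cker.
  by rewrite linearB linearD linearZ /= !gK subrr.
pose f : {linear 'cV[R]_m -> R^o} := HB.pack (fun y => c (g y) : R^o)
  (GRing.isLinear.Build R 'cV[R]_m R^o *:%R (fun y => c (g y) : R^o) lin).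
exists f => x; apply/eqP; rewrite -subr_eq0 /f /= -linearB; apply/eqP/cker.
by rewrite linearB /= gK subrr.
Qed.

Section CentralPath.
Variables (R : realType) (d m n : nat) (p : mpoly.mpoly d R) (e0 : 'cV[R]_d).
Variables (A : {linear 'cV[R]_d -> 'cV[R]_m}) (b : 'cV[R]_m).
Variable c : {linear 'cV[R]_d -> R^o}.
Hypothesis hp : p \is mpoly.ishomog1 n mpoly.mdeg.
Hypothesis he0 : hyperbolic p e0.

(** Fermat's rule at [s = 0] on the line [z + s v], restricted to an interval where [p] stays
    positive: there [ln] is differentiable and the points remain in the component of [z]. *)
Lemma central_path_gradient (z : 'cV[R]_d) : central_path p e0 A b c z ->
  exists2 eta : R, 0 < eta &
    forall v, A v = 0 -> grad_at p z v = eta * peval p z * (c v : R).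
Proof.
move=> [eta eta0 [[Dz Az] zmin]]; exists eta => // v Av.
have pz : 0 < peval p z := connected_component_sub Dz.
have cline : continuous (fun s : R => peval p (z + s *: v)).
  move=> s; apply: (@continuous_comp _ _ _ (fun s : R => z + s *: v) (peval p)).
    by apply: cvgD; [exact: cvg_cst | exact: scalel_continuous].
  exact: continuous_peval.
have [del del0 posl] : exists2 del : R, 0 < del &
    forall s : R, `|s| < del -> 0 < peval p (z + s *: v).
  have /nbhs_ballP[del del0 hdel] : nbhs (0 : R) [set s | 0 < peval p (z + s *: v)].
    by apply: open_nbhs_nbhs; split; [exact: open_positive | rewrite /= scale0r addr0].
  by exists del => // s sdel; apply: hdel; rewrite /ball /= sub0r normrN.
pose f (s : R) : R := eta * (c z + s * c v) - ln (peval p (z + s *: v)).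
have df (s : R) : `|s| < del ->
    is_derive s 1 f (eta * c v - (peval p (z + s *: v))^-1 * grad_at p (z + s *: v) v).
  move=> /posl ps; have dline := is_derive_peval_line p z v s.
  have dln := is_derive1_comp (is_derive1_ln ps) dline.
  have daff : is_derive s 1 (fun s : R => eta * (c z + s * c v)) (eta * c v).
    rewrite (_ : (fun _ => _) = eta \*: (cst (c z : R) + ((c v : R) \*: (@id R)))); last first.
      by apply/funext => r /=; rewrite [r * _]mulrC.
    by apply: is_derive_eq; rewrite add0r [X in eta *: X]mulr1.
  exact: is_deriveB daff dln.
have f00 : is_derive (0 : R) 1 f 0.
  apply: (@derive1_at_min _ f (- del) del).
  - by rewrite ge0_cp // ltW.
  - by move=> s; rewrite in_itv /= -ltr_norml => /df[].
  - by rewrite in_itv /= oppr_lt0 del0.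
  - move=> s; rewrite in_itv /= -ltr_norml => sdel.
    have : strictly_feasible p e0 A b (z + s *: v).
      split; last by rewrite linearD linearZ /= Av scaler0 addr0.
      apply: open_cone_segment Dz _ => t /andP[t0 t1]; rewrite scalerA; apply: posl.
      by rewrite normrM (le_lt_trans _ sdel) // ger0_norm // ler_piMl.
    move=> /zmin; rewrite /f scale0r addr0 mul0r addr0.
    by rewrite linearD linearZ /=.
have d0 := df 0; rewrite normr0 in d0; have {}d0 := d0 del0.
have := @derive_val _ _ _ _ _ _ _ d0; rewrite (@derive_val _ _ _ _ _ _ _ f00).
rewrite scale0r addr0 => /esym/eqP; rewrite subr_eq0 => /eqP cg.
by rewrite mulrAC cg mulrC mulrA divff ?mul1r // gt_eqF.
Qed.

(** The tangent inequality at [z] requires hyperbolicity along [z], which [garding_hyperbolic]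
    supplies; on the difference of two feasible points the gradient is the objective up to the
    factor [eta * peval p z]. *)
Lemma central_path_of_gradient (eta : R) (z : 'cV[R]_d) :
  strictly_feasible p e0 A b z -> 0 < eta ->
  (forall v, A v = 0 -> grad_at p z v = eta * peval p z * (c v : R)) ->
  central_path p e0 A b c z.
Proof.
move=> [Dz Az] eta0 gz; exists eta => //; split=> // y [Dy Ay].
have pz : 0 < peval p z := connected_component_sub Dz.
have hz := garding_hyperbolic hp he0 Dz.
have Dzy : open_cone (peval p) z y.
  exact: connected_component_trans (connected_component_sym Dz) Dy.
have : ln (peval p y) <= ln (peval p z) + grad_at p z (y - z) / peval p z.
  apply: (ln_le_tangent hp hz); first exact: connected_component_sub Dy.
  move=> s s0; have := @open_cone_root_free _ _ _ _ _ _ (s%:C%C) hp hz Dzy s0.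
  apply: contra_neq => ps0.
  transitivity (real_complex R (peval p (y + s *: z))); last by rewrite ps0.
  rewrite -peval_real_complex; congr (mpoly.mmap _ _ p); apply/funext => i.
  by rewrite !mxE rmorphD rmorphM.
rewrite gz ?linearB /= ?Ay ?Az ?subrr // mulrAC mulfK ?gt_eqF //.
rewrite mulrBr; move: (eta * c y) (eta * c z) => u w.
by move: (ln _) (ln _) => lu lw; lra.
Qed.

End CentralPath.

Section Trajectory.
Variables (R : realType) (d : nat) (T : \bar R) (e : R -> 'cV[R]_d) (t : R) (l : 'cV[R]_d).
Hypothesis tT : (t%:E < T)%E.
Hypothesis quot :
  (s - t)^-1 *: (e s - e t) @[s --> within (time_interval T `\ t) (nbhs t)] --> l.

Let quot_coord i :
  (s - t)^-1 * (e s i 0 - e t i 0) @[s --> within (time_interval T `\ t) (nbhs t)] --> l i 0.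
Proof.
have E : (fun s => (s - t)^-1 * (e s i 0 - e t i 0)) =
    (fun M : 'cV[R]_d => M i 0) \o (fun s => (s - t)^-1 *: (e s - e t)).
  by apply/funext => s /=; rewrite !mxE.
rewrite E; apply: cvg_comp quot _; exact: coord_continuous.
Qed.

Let lt_horizon : \forall s \near t, (s%:E < T)%E.
Proof.
case: T tT => [r| |] //= tr; last by near=> s; rewrite ltry.
have tr' : t < r by rewrite -lte_fin.
by near=> s; rewrite lte_fin; near: s; exact: lt_nbhsl.
Unshelve. all: by end_near.
Qed.

(** All times near [t] lie in [[0, T)] when [0 < t < T], so the restricted limit is an ordinary
    derivative. *)
Lemma trajectory_is_derive i : 0 < t -> is_derive t 1 (fun s => e s i 0) (l i 0).
Proof.
move=> t0.
have lim : (fun h : R => h^-1 *: (((fun s => e s i 0) \o shift t) (h *: (1 : R)) - e t i 0))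
    @ 0^' --> l i 0.
  apply/cvgrPdist_lt => eps eps0.
  have /cvgrPdist_lt/(_ eps eps0) nq := @quot_coord i.
  have : \forall s \near t, s != t -> `|l i 0 - (s - t)^-1 * (e s i 0 - e t i 0)| < eps.
    have tpos : \forall s \near t, 0 < s by exact: lt_nbhsr.
    move: nq; rewrite /= /within /= => nq.
    near=> s => st; have : (time_interval T `\ t) s ->
       `|l i 0 - (s - t)^-1 * (e s i 0 - e t i 0)| < eps by near: s.
    apply; split; last exact/eqP.
    by split; [apply: ltW; near: s | near: s].
  move=> /nbhs_ballP[del del0 hdel]; apply/nbhs_ballP; exists del => //= h.
  rewrite /ball /= sub0r normrN => hdel' h0.
  have := hdel (h + t); rewrite /ball /= opprD addrCA subrr addr0 normrN => /(_ hdel').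
  rewrite -subr_eq0 addrK => /(_ h0).
  by rewrite [h%:A]mulr1.
apply: DeriveDef; first by apply/cvg_ex; exists (l i 0).
exact/cvg_lim.
Unshelve. all: by end_near.
Qed.

(** At the initial time the difference quotient converges only from the right; multiplied by [s] it
    gives the continuity that the monotonicity argument asks of this endpoint. *)
Lemma trajectory_right_continuous i : t = 0 -> e s i 0 @[s --> 0^'+] --> e 0 i 0.
Proof.
move=> t0; move: (@quot_coord i) lt_horizon; rewrite t0 => quot0 horizon0.
have q0 : (s - 0) ^-1 * (e s i 0 - e 0 i 0) @[s --> 0^'+] --> l i 0.
  apply: cvg_trans quot0; apply: cvg_app => P; rewrite /within /=.
  apply: filterS2 horizon0 => s sT SP s0; apply: SP.
  by split; [split=> //; exact: ltW | apply/eqP; rewrite gt_eqF].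
have id0 : s - 0 @[s --> (0 : R)^'+] --> (0 : R).
  by apply: cvg_at_right_filter; rewrite -[X in _ --> X](subr0 0); apply: cvgB;
     [exact: cvg_id | exact: cvg_cst].
have lim : (s - 0) * ((s - 0)^-1 * (e s i 0 - e 0 i 0)) + e 0 i 0 @[s --> 0^'+] --> e 0 i 0.
  rewrite -[X in _ --> X]add0r -[X in _ --> X + _](mul0r (l i 0)).
  exact: cvgD (cvgM id0 q0) (cvg_cst (e 0 i 0)).
apply: cvg_trans lim; apply: near_eq_cvg; near=> s.
rewrite mulrA divff ?mul1r ?subrK // subr0 gt_eqF //; near: s; exact: nbhs_right_gt.
Unshelve. all: by end_near.
Qed.

End Trajectory.

Section Dynamics.
Variables (R : realType) (d m n : nat) (p : mpoly.mpoly d R) (e0 : 'cV[R]_d).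
Variables (A : {linear 'cV[R]_d -> 'cV[R]_m}) (b : 'cV[R]_m).
Variable c : {linear 'cV[R]_d -> R^o}.
Hypothesis n2 : (2 <= n)%N.
Hypothesis hp : p \is mpoly.ishomog1 n mpoly.mdeg.
Hypothesis he0 : hyperbolic p e0.
Variables (T : \bar R) (e : R -> 'cV[R]_d).
Hypothesis e_traj : trajectory p e0 A b c (n - 2) T e.

(* By Euler's identity [D^2p(e)[e, v] = (n - 1) Dp(e)[v]], the derivative of
   [Dp(e(t))[v] exp((n - 1) t)] is [D^2p(e(t))[x(t), v] exp((n - 1) t)], where [x(t)]
   is the optimal point at time [t]. *)
Lemma trajectory_gradient_monotone (u v : 'cV[R]_d) (t : R) :
  A u = 0 -> 0 < (c u : R) -> A v = 0 -> 0 <= (c v : R) -> time_interval T t ->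
  grad_at p (e 0) v <= grad_at p (e t) v * expR ((n%:R - 1) * t).
Proof.
move=> Au cu Av cv [t0 tT].
move: t0; rewrite le_eqVlt => /predU1P[<-|t0]; first by rewrite mulr0 expR0 mulr1.
have inT s : 0 <= s <= t -> time_interval T s.
  by move=> /andP[s0 st]; split=> //; apply: le_lt_trans tT; rewrite lee_fin.
pose x s := opt_point p A b c (n - 2) (e s).
pose Phi s := grad_at p (e s) v * expR ((n%:R - 1) * s).
have dPhi s : 0 < s <= t ->
    is_derive s 1 Phi (hess_at p (e s) (x s) v * expR ((n%:R - 1) * s)).
  move=> /andP[s0 st]; have sT : time_interval T s by apply: inT; rewrite (ltW s0).
  have [_ quot] := e_traj.2 s sT.
  have dcoord i := trajectory_is_derive sT.2 quot i s0.
  have dg : is_derive s 1 (fun r => grad_at p (e r) v) (hess_at p (e s) (x s - e s) v).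
    exact: (is_derive_meval (gam := fun r => coords (e r))).
  have dl : is_derive s 1 (fun r : R => (n%:R - 1) * r) (n%:R - 1).
    rewrite (_ : (fun _ => _) = (n%:R - 1) \*: (@id R)) //.
    by apply: is_derive_eq; rewrite [_ *: _]mulr1.
  have de := is_derive1_comp (is_derive_expR ((n%:R - 1) * s)) dl.
  apply: is_derive_eq (is_deriveM dg de) _.
  rewrite [x s - e s]addrC -(scaleN1r (e s)) hess_at_linl (hess_at_sym p (e s) (e s) v).
  rewrite (hess_at_self _ hp).
  by rewrite /= /GRing.scale /=; ring.
have hx s : time_interval T s -> 0 <= hess_at p (e s) (x s) v.
  move=> sT; have [[[[Ds _] opt] _] _] := e_traj.2 s sT.
  have hs := garding_hyperbolic hp he0 Ds.
  (* Membership in [Swath] makes [Opt_der] nonempty, so the value of [get] is an optimal point. *)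
  by apply: (optimal_gradient n2 hp hs (getPex opt) Au cu Av cv).
have PhiE : Phi 0 = grad_at p (e 0) v by rewrite /Phi mulr0 expR0 mulr1.
rewrite -PhiE; apply: (@ger0_derive1_le_cc _ Phi 0 t).
- by move=> s; rewrite in_itv /= => /andP[s0 st]; case: (dPhi s); rewrite // s0 ltW.
- move=> s; rewrite in_itv /= => /andP[s0 st]; rewrite derive1E.
  have [|_ ->] := dPhi s; first by rewrite s0 ltW.
  by apply: mulr_ge0; [apply/hx/inT; rewrite !ltW | exact: expR_ge0].
- have cPhi s : 0 < s <= t -> {for s, continuous Phi}.
    by move=> /dPhi[dP _]; apply/differentiable_continuous/derivable1_diffP.
  apply/continuous_within_itvP => //; split.
  + by move=> s; rewrite in_itv /= => /andP[s0 st]; apply: cPhi; rewrite s0 ltW.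
  + apply: cvgM.
      have T0 : time_interval T 0 by apply: inT; rewrite lexx ltW.
      have [_ quot] := e_traj.2 0 T0.
      apply: (@cvg_meval _ _ _ _ _ (fun r => coords (e r))) => i.
      exact: trajectory_right_continuous T0.2 quot i erefl.
    apply: cvg_at_right_filter.
    apply: (@continuous_comp _ _ _ (fun r : R => (n%:R - 1) * r) expR).
      exact: mulrl_continuous.
    exact: continuous_expR.
  + by apply: cvg_at_left_filter; apply: cPhi; rewrite t0 lexx.
- by rewrite in_itv /= lexx ltW.
- by rewrite in_itv /= lexx ltW.
- exact: ltW.
Qed.

End Dynamics.

Unset Implicit Arguments.

Theorem theorem5 (R : realType) (d m n : nat)
    (p : mpoly.mpoly d R) (e0 : 'cV[R]_d)
    (A : {linear 'cV[R]_d -> 'cV[R]_m}) (b : 'cV[R]_m)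
    (c : {linear 'cV[R]_d -> R^o})
    (hn : (2 <= n)%N)
    (p_homog : p \is mpoly.ishomog1 n mpoly.mdeg)
    (p_hyp : hyperbolic p e0)
    (Lambda_regular : regular_cone (closed_cone (peval p) e0))
    (A_surj : forall y : 'cV[R]_m, exists x : 'cV[R]_d, A x = y)
    (b_neq0 : b != 0)
    (c_notin : ~ exists y : {linear 'cV[R]_m -> R^o}, forall x, c x = y (A x))
    (T : \bar R) (e : R -> 'cV[R]_d)
    (e_traj : maximal_trajectory p e0 A b c (n - 2)%N T e)
    (e_start : central_path p e0 A b c (e 0)) :
  [set e t | t in time_interval T] `<=` central_path p e0 A b c.
Proof.
move=> _ [t tT <-]; have traj := e_traj.1.
have [[et_feas _] _] := (traj.2 t tT).1.
have [u Au cu] := kernel_direction A_surj c_notin.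
have [eta eta0 g0] := central_path_gradient e_start.
have pos z : strictly_feasible p e0 A b z -> 0 < peval p z.
  by move=> [/connected_component_sub].
have p0 : 0 < peval p (e 0) by apply: pos; case: e_start => ? _ [].
have pt := pos _ et_feas.
have ge0 v : A v = 0 -> 0 <= (c v : R) ->
    eta * peval p (e 0) * (c v : R) <= grad_at p (e t) v * expR ((n%:R - 1) * t).
  move=> Av cv; rewrite -g0 //.
  exact: (trajectory_gradient_monotone hn p_homog p_hyp traj Au cu Av cv tT).
have gu : 0 < grad_at p (e t) u.
  rewrite -(pmulr_lgt0 _ (expR_gt0 ((n%:R - 1) * t))).
  by apply: lt_le_trans (ge0 _ Au (ltW cu)); rewrite !mulr_gt0.
have gker v : A v = 0 -> (c v : R) = 0 -> 0 <= grad_at p (e t) v.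
  move=> Av cv; have := ge0 v Av; rewrite cv lexx mulr0 => /(_ isT).
  by rewrite pmulr_lge0 ?expR_gt0.
(* The ratio of the gradient to [c] on [ker A], read off at [u]; division by [peval p (e t)] gives
   the path parameter. *)
pose k := grad_at p (e t) u / (c u : R).
have k0 : 0 < k by rewrite divr_gt0.
apply: (central_path_of_gradient p_homog p_hyp (eta := k / peval p (e t))) => //.
  by rewrite divr_gt0.
move=> v Av; rewrite divfK ?gt_eqF // /k.
(* [w] is [v] corrected along [u] to have [c w = 0]; [gker] for [w] and [- w] then kills its
   gradient. *)
pose w := (- ((c v : R) / (c u : R))) *: u + v.
have Aw : A w = 0 by rewrite linearD linearZ /= Au Av scaler0 addr0.
have cw : (c w : R) = 0.
  by rewrite linearD linearZ /= [_ *: _]mulNr divfK ?gt_eqF // addNr.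
have gw : grad_at p (e t) w = 0.
  apply/eqP; rewrite eq_le gker // andbT -oppr_ge0 -grad_atN.
  by apply: gker; rewrite linearN /= ?Aw ?cw oppr0.
move: gw; rewrite grad_at_lin => /eqP; rewrite mulNr addrC subr_eq0 => /eqP ->.
by rewrite mulrAC [_ * (c v : R)]mulrC mulrA.
Qed.
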